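(* Let $\mathcal S^{\mathsf a}$ and $\mathcal S^{\mathsf m}$ be two families of finite sets in $\mathbb N$ which have the following properties: (i) any additively large set in $\mathbb N$ contains a configuration of the form $a+F_1$ for some $F_1\in\mathcal S^{\mathsf a}$ and $a\in\mathbb N$; (ii) any multiplicatively large set in $\mathbb N$ contains a configuration of the form $bF_2$ for some $F_2\in\mathcal S^{\mathsf m}$ and $b\in\mathbb N$. Then any classical normal set $A\subset\mathbb N$ contains a configuration $bF_2(a+F_1)$ with $F_1\in\mathcal S^{\mathsf a}$, $F_2\in\mathcal S^{\mathsf m}$ and $a,b\in\mathbb N$. In particular, any classical normal set $A$ contains, for any $n\in\mathbb N$, configurations of the form $\{q^j(a+id):\ 0\le i,j\le n\}$ with some $q>1$, $a,d\in\mathbb N$.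
   Context: $\mathbb N=\{1,2,\dots\}$ (and $q\in\mathbb N$). For sets, $a+F=\{a+f:f\in F\}$, $bF=\{bf:f\in F\}$ and $bF_2(a+F_1)=\{b f_2(a+f_1): f_1\in F_1,f_2\in F_2\}$. A F{\o}lner sequence in $(\mathbb N,* )$, where $*$ is $+$ or $\times$, is a sequence $(F_n)$ of (nonempty) finite subsets of $\mathbb N$ with $\lim_n\frac1{|F_n|}|\{h\in F_n: g*h\in F_n\}|=1$ for every $g\in\mathbb N$. The upper $(F_n)$-density of $S\subset\mathbb N$ is $\overline d_{(F_n)}(S)=\limsup_n|F_n\cap S|/|F_n|$. A set $S$ is additively (multiplicatively) large if there exists a F{\o}lner sequence $(F_n)$ in $(\mathbb N,+)$ (respectively $(\mathbb N,\times)$) with $\overline d_{(F_n)}(S)>0$. A set $A\subset\mathbb N$ is classical normal if its indicator sequence $x=\mathbf 1_A$ is normal: for every $k\in\mathbb N$ and every word $w\in\{0,1\}^k$, $\lim_{n\to\infty}\frac1n|\{m\in\{1,\dots,n-k+1\}:\langle x_m,\dots,x_{m+k-1}\rangle=w\}|=2^{-k}$. *)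

(* Defs.v *)
From HB Require Import structures.
From mathcomp Require Import all_boot all_order all_algebra finmap.
From mathcomp Require Import all_classical all_reals all_analysis.

Set Implicit Arguments.
Unset Strict Implicit.
Unset Printing Implicit Defensive.

Import Order.TTheory GRing.Theory Num.Theory.
Import numFieldNormedType.Exports.

Local Open Scope classical_set_scope.
Local Open Scope ring_scope.

(* The natural numbers here are {1, 2, ...}; subsets are taken in [set nat]
   and required to avoid 0. *)
Definition posnat : set nat := [set n | (0 < n)%N].

Definition finset_in_posnat (F : {fset nat}) : Prop :=
  [set x | x \in F] `<=` posnat.

(* [op] is the semigroup operation on [posnat]: [addn] or [muln]. *)
Definition folner (R : realType) (op : nat -> nat -> nat)
    (F : nat -> {fset nat}) : Prop :=
  [/\ forall n, F n != fset0,
      forall n, finset_in_posnat (F n) &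
      forall g, posnat g ->
        (#|` [fset h in F n | op g h \in F n]%fset|%:R / #|` F n|%:R : R)
          @[n --> \oo] --> (1 : R)].

Definition upper_density (R : realType) (F : nat -> {fset nat})
    (S : set nat) : R :=
  limn_sup (fun n => #|` [fset h in F n | h \in S]%fset|%:R / #|` F n|%:R : R).

Definition large (R : realType) (op : nat -> nat -> nat) (S : set nat) : Prop :=
  exists F : nat -> {fset nat}, folner R op F /\ 0 < upper_density R F S.

Definition additively_large (R : realType) (S : set nat) : Prop :=
  large R addn S.

Definition multiplicatively_large (R : realType) (S : set nat) : Prop :=
  large R muln S.

(* Positions are counted from 1 ([x 0] is never read). With truncated
   subtraction, [n.+1 - k] is n - k + 1 if k <= n + 1 and 0 otherwise, so
   [iota 1 (n.+1 - k)] lists {1, ..., n - k + 1}. *)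
Definition word_count (x : nat -> bool) (w : seq bool) (n : nat) : nat :=
  count (fun m => [seq x i | i <- iota m (size w)] == w)
        (iota 1 (n.+1 - size w)).

Definition normal_sequence (R : realType) (x : nat -> bool) : Prop :=
  forall k : nat, (0 < k)%N -> forall w : k.-tuple bool,
    ((word_count x w n)%:R / n%:R : R) @[n --> \oo] --> (2^-1 ^+ k : R).

Definition classical_normal (R : realType) (A : set nat) : Prop :=
  A `<=` posnat /\ normal_sequence R (fun m => m \in A).

Definition translate (a : nat) (F : {fset nat}) : set nat :=
  [set (a + f)%N | f in [set x | x \in F]].

Definition dilate (b : nat) (F : {fset nat}) : set nat :=
  [set (b * f)%N | f in [set x | x \in F]].

Definition dilate_translate (b : nat) (F2 : {fset nat}) (a : nat)
    (F1 : {fset nat}) : set nat :=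
  [set (b * f2 * (a + f1))%N | f1 in [set x | x \in F1]
                             & f2 in [set x | x \in F2]].

Definition geo_arithmetic (q a d n : nat) : set nat :=
  [set (q ^ j * (a + i * d))%N | i in [set i | (i <= n)%N]
                               & j in [set j | (j <= n)%N]].

(* Main.v *)
Require Import Defs.
From mathcomp Require Import all_boot all_order all_algebra finmap.
From mathcomp Require Import all_classical all_reals all_analysis.
From mathcomp Require Import ring lra zify.

(** Normality of A is a purely additive property, so little is known about
    the simultaneous behaviour of its dilates A / b. Two facts suffice.

    First, A contains at least one eighth of the multiples of each j
    ([normal_multiples]): most long words have many ones in each residue class of
    positions, hence so do most windows of A. Secondly, additive largeness is
    finitary ([additively_large_finitary]): by compactness there is N such that
    each set containing a sixteenth of the integers up to N contains some a + F1
    with F1 in the additive family.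

    Fix this N and a multiplicative Folner sequence K n. Averaging over c gives
    a dilate c n K n such that, for a positive proportion of its elements y, the
    word of A along y, 2 y, ..., N y has at least N / 16 ones. As there are only
    2^N words, one word s occurs for a multiplicatively large set of y
    ([popular_section]). This set contains some b F2, and the set of ones of s
    contains some a + F1. So y (a + f1) lies in A for each y in b F2 and f1 in F1.

    For the second part, the families are those of the arithmetic and of the
    geometric progressions of a given length. That they satisfy the hypotheses is
    Szemeredi's theorem, additively and multiplicatively. Both follow from the
    density Hales-Jewett theorem ([DHJ_valued]): in a Folner set some point h is
    moved into the large set by a dense set of words, acting through the sum of
    their letters ([large_pattern]), and a line of words acts by a progression.

    The density Hales-Jewett theorem is proved by adding one letter, None, to an
    alphabet X at a time ([DHJ_option]). Among the line-free sets over option X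
    consider one of nearly maximal density al. The theorem over X provides many
    lines over X inside it; their last points, with None for the variable, form
    in a suitable cube a set D which the given set avoids and whose density is at
    least some c that depends on al only ([popular_fill]). As D is an
    intersection of insensitive sets, one for each letter i of X, which do not
    distinguish None and i, so are the pieces of a partition of its complement.
    Such intersections are almost tiled by large subspaces ([many_insensitive]),
    again by the theorem over X, and on each of these the density is at most about
    al. So the total density is at most about al (1 - c), which is a contradiction.
    Choosing a nearly extremal set replaces the usual density increment. *)

Set Implicit Arguments.
Unset Strict Implicit.
Unset Printing Implicit Defensive.

Import Order.TTheory GRing.Theory Num.Theory.
Import numFieldNormedType.Exports.
Local Open Scope ring_scope.

(** * Averages over finite types *)

Section Averages.
Variable R : realType.
Implicit Types S T : finType.

Definition avg T (f : T -> R) : R := (\sum_x f x) / #|T|%:R.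

Lemma eq_avg T (f g : T -> R) : f =1 g -> avg f = avg g.
Proof. by move=> fg; rewrite /avg (eq_bigr g). Qed.

Lemma avg_cst T (c : R) : (0 < #|T|)%N -> avg (fun _ : T => c) = c.
Proof.
move=> T0; rewrite /avg sumr_const -[c *+ _]mulr_natr mulfK //.
by rewrite pnatr_eq0 -lt0n.
Qed.

Lemma avgD T (f g : T -> R) : avg (fun x => f x + g x) = avg f + avg g.
Proof. by rewrite /avg big_split mulrDl. Qed.

Lemma avgZ T (c : R) (f : T -> R) : avg (fun x => c * f x) = c * avg f.
Proof. by rewrite /avg -mulr_sumr mulrA. Qed.

Lemma avgN T (f : T -> R) : avg (fun x => - f x) = - avg f.
Proof. by rewrite /avg sumrN mulNr. Qed.

Lemma avgB T (f g : T -> R) : avg (fun x => f x - g x) = avg f - avg g.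
Proof. by rewrite avgD avgN. Qed.

Lemma avg_sum T (J : finType) (P : pred J) (F : J -> T -> R) :
  avg (fun x => \sum_(j | P j) F j x) = \sum_(j | P j) avg (F j).
Proof. by rewrite /avg exchange_big mulr_suml. Qed.

Lemma ler_avg T (f g : T -> R) : (forall x, f x <= g x) -> avg f <= avg g.
Proof. by move=> fg; rewrite ler_wpM2r ?invr_ge0 ?ler0n ?ler_sum. Qed.

Lemma avg_ge0 T (f : T -> R) : (forall x, 0 <= f x) -> 0 <= avg f.
Proof. by move=> f0; rewrite mulr_ge0 ?invr_ge0 ?ler0n ?sumr_ge0. Qed.

Lemma avg_le_cst T (f : T -> R) c :
  (0 < #|T|)%N -> (forall x, f x <= c) -> avg f <= c.
Proof. by move=> T0 fc; rewrite -(avg_cst c T0) ler_avg. Qed.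

Lemma avg_ge_cst T (f : T -> R) c :
  (0 < #|T|)%N -> (forall x, c <= f x) -> c <= avg f.
Proof. by move=> T0 fc; rewrite -(avg_cst c T0) ler_avg. Qed.

Lemma avg_attained T (f : T -> R) c :
  (0 < #|T|)%N -> c <= avg f -> exists x, c <= f x.
Proof.
move=> T0 cf; apply: contrapT => /forallNP fc.
suff : avg f < c by rewrite ltNge cf.
rewrite -(avg_cst c T0) /avg ltr_pM2r ?invr_gt0 ?ltr0n //.
have [x0 _] := card_gt0P T0.
apply: ltr_sum => [|x _]; first by apply/hasP; exists x0; rewrite ?mem_index_enum.
by rewrite ltNge; apply/negP/fc.
Qed.

Lemma avg_bij S T (h : S -> T) (f : T -> R) :
  bijective h -> avg f = avg (fun x => f (h x)).
Proof.
move=> hb; rewrite /avg (reindex h) ?(bij_eq_card hb) //.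
by have [g] := hb; exists g => x _.
Qed.

Lemma avg_pair S T (f : S * T -> R) :
  avg f = avg (fun x => avg (fun y => f (x, y))).
Proof.
rewrite /avg card_prod natrM invfM mulrA [in LHS]mulrAC.
rewrite -[in RHS]mulr_suml; congr (_ * _).
congr (_ / _); rewrite pair_big /=; apply: eq_bigr => -[] //.
Qed.

Lemma exchange_avg S T (f : S -> T -> R) :
  avg (fun x => avg (fun y => f x y)) = avg (fun y => avg (fun x => f x y)).
Proof.
rewrite -(avg_pair (fun p => f p.1 p.2)) -(avg_pair (fun p => f p.2 p.1)).
by rewrite (@avg_bij _ _ (fun p => (p.2, p.1))) //; exists (fun p => (p.2, p.1)) => -[].
Qed.

(** The coordinates of a uniformly random word are independent. *)
Lemma avg_prod (I X : finType) (F : I -> X -> R) :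
  avg (fun x : {ffun I -> X} => \prod_i F i (x i)) = \prod_i avg (F i).
Proof.
rewrite /avg -bigA_distr_bigA /= big_split /= prodfV; congr (_ / _).
by rewrite card_ffun prodr_const natrX.
Qed.

Definition dens T (A : pred T) : R := avg (fun x => (A x)%:R).

Lemma dens_ge0 T (A : pred T) : 0 <= dens A.
Proof. by apply: avg_ge0 => x; rewrite ler0n. Qed.

Lemma dens_le1 T (A : pred T) : (0 < #|T|)%N -> dens A <= 1.
Proof. by move=> T0; apply: avg_le_cst => // x; rewrite lern1 leq_b1. Qed.

Lemma dens_attained T (A : pred T) : 0 < dens A -> exists x, A x.
Proof.
move=> A0; apply: contrapT => /forallNP NA; move: A0.
rewrite /dens /avg big1 ?mul0r ?ltxx // => x _.
by have /negP/negbTE-> := NA x.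
Qed.

Lemma le_dens T (A B : pred T) : (forall x, A x -> B x) -> dens A <= dens B.
Proof.
move=> AB; apply: ler_avg => x; rewrite ler_nat.
by have := AB x; case: (A x) => // /(_ isT) ->.
Qed.

End Averages.

(** * Words, lines and subspaces *)

Section Words.
Implicit Types I J S P X Y : finType.

(** A combinatorial line of X^I is encoded by a word over option X: None is the
    variable of the line, and [inst u a] is its point with parameter a. *)
Definition inst I X (u : {ffun I -> option X}) (a : X) : {ffun I -> X} :=
  [ffun i => odflt a (u i)].

Definition variable I X (u : {ffun I -> option X}) : bool :=
  [exists i, u i == None].

Definition line_free I X (A : pred {ffun I -> X}) : Prop :=
  forall u : {ffun I -> option X}, variable u -> ~ forall a, A (inst u a).

(** A combinatorial subspace of Y^I with parameters in Y^S; coordinate i is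
    either a fixed letter or a copy of parameter s. It is nondegenerate, hence
    a copy of Y^S, when it is [wide]. *)
Definition app I S Y (w : {ffun I -> Y + S}) (x : {ffun S -> Y}) :
    {ffun I -> Y} :=
  [ffun i => match w i with inl a => a | inr s => x s end].

Definition wide I S Y (w : {ffun I -> Y + S}) : Prop :=
  forall s, exists i, w i = inr s.

Definition join I J Y (x : {ffun I -> Y}) (y : {ffun J -> Y}) :
    {ffun I + J -> Y} :=
  [ffun k => match k with inl i => x i | inr j => y j end].

Lemma inst_join I J X (u : {ffun I -> option X}) (v : {ffun J -> option X}) a :
  inst (join u v) a = join (inst u a) (inst v a).
Proof. by apply/ffunP => -[i|j]; rewrite !ffunE. Qed.

Lemma app_inj I S Y (w : {ffun I -> Y + S}) : wide w -> injective (app w).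
Proof.
move=> ww x y xy; apply/ffunP => s; have [i wi] := ww s.
by move/ffunP: xy => /(_ i); rewrite !ffunE wi.
Qed.

(** A line in the parameters of a subspace is a line. *)
Lemma line_free_app I S Y (A : pred {ffun I -> Y}) (w : {ffun I -> Y + S}) :
  wide w -> line_free A -> line_free (fun x => A (app w x)).
Proof.
move=> ww lfA u /existsP[s /eqP us] uA.
pose u' := [ffun i => match w i with inl a => Some a | inr s => u s end].
apply: (lfA u') => [|a].
  by have [i wi] := ww s; apply/existsP; exists i; rewrite ffunE wi us.
suff -> : inst u' a = app w (inst u a) by [].
by apply/ffunP => i; rewrite !ffunE; case: (w i) => // s'; rewrite ffunE.
Qed.

Lemma line_free_joinr I J Y (A : pred {ffun I + J -> Y}) (x : {ffun I -> Y}) :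
  line_free A -> line_free (fun y => A (join x y)).
Proof.
move=> lfA u /existsP[j /eqP uj] uA.
apply: (lfA (join [ffun i => Some (x i)] u)) => [|a].
  by apply/existsP; exists (inr j); rewrite ffunE uj.
rewrite inst_join; suff -> : inst [ffun i => Some (x i)] a = x by [].
by apply/ffunP => i; rewrite !ffunE.
Qed.

Definition comp I S P Y (w : {ffun I -> Y + S}) (v : {ffun S -> Y + P}) :
    {ffun I -> Y + P} :=
  [ffun i => match w i with inl a => inl a | inr s => v s end].

Lemma app_comp I S P Y (w : {ffun I -> Y + S}) (v : {ffun S -> Y + P}) x :
  app (comp w v) x = app w (app v x).
Proof.
by apply/ffunP => i; rewrite !ffunE; case: (w i) => // s; rewrite ffunE.
Qed.

Lemma wide_comp I S P Y (w : {ffun I -> Y + S}) (v : {ffun S -> Y + P}) :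
  wide w -> wide v -> wide (comp w v).
Proof.
move=> ww wv p; have [s vs] := wv p; have [i wi] := ww s.
by exists i; rewrite ffunE wi vs.
Qed.

Definition mapl I S X Y (g : X -> Y) (w : {ffun I -> X + S}) :
    {ffun I -> Y + S} :=
  [ffun i => match w i with inl a => inl (g a) | inr s => inr s end].

Lemma inst_app I S X (w : {ffun I -> option X + S}) (x : {ffun S -> option X}) a :
  inst (app w x) a = app (mapl (odflt a) w) (inst x a).
Proof.
by apply/ffunP => i; rewrite !ffunE; case: (w i) => // s; rewrite ffunE.
Qed.

Lemma card_word_gt0 I X : (0 < #|X|)%N -> (0 < #|{ffun I -> X}|)%N.
Proof. by move=> X0; rewrite card_ffun expn_gt0 X0. Qed.

Lemma card_opt_gt0 X : (0 < #|{: option X}|)%N.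
Proof. by rewrite card_option. Qed.

End Words.

Section DenseLines.
Variable R : realType.
Implicit Types I J S P X Y : finType.

Lemma avg_join I J Y (f : {ffun I + J -> Y} -> R) :
  avg f = avg (fun x => avg (fun y => f (join x y))).
Proof.
rewrite (@avg_bij _ _ _ (fun p => join p.1 p.2)) ?avg_pair //.
exists (fun z : {ffun I + J -> Y} =>
  ([ffun i => z (inl i)] : {ffun I -> Y}, [ffun j => z (inr j)] : {ffun J -> Y})).
  by move=> [x y]; congr pair; apply/ffunP => i; rewrite !ffunE.
by move=> z; apply/ffunP => -[i|j]; rewrite !ffunE.
Qed.

Definition forces_line X (d : R) I : Prop :=
  forall A : pred {ffun I -> X}, d <= dens R A -> ~ line_free A.

(** The density Hales-Jewett theorem over the alphabet X. One dimension suffices,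
    since averaging over fibres passes to larger dimensions. *)
Definition DHJ X : Prop := forall d : R, 0 < d -> exists I, forces_line X d I.

(** If the sections over T have average density 2 d, those denser than d have
    total weight at least d; each contains a line, and there are boundedly many
    lines, so one line lies in the sections over a positive proportion of T. *)
Lemma forces_line_popular X (d : R) I (T : finType)
    (A : {ffun I -> X} -> T -> bool) :
  (0 < #|X|)%N -> (0 < #|T|)%N -> 0 < d -> forces_line X d I ->
  d *+ 2 <= avg (fun x => avg (fun t => (A x t)%:R)) ->
  exists2 u : {ffun I -> option X}, variable u &
    d / #|{ffun I -> option X}|%:R <= dens R (fun t => [forall a, A (inst u a) t]).
Proof.
move=> X0 T0 d0 HI dA.
pose W : finType := {ffun I -> option X}.
have W0 : (0 < #|W|)%N by apply/card_word_gt0/card_opt_gt0.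
have X0' : (0 < #|{ffun I -> X}|)%N by apply: card_word_gt0.
pose g (u : W) := dens R (fun t => variable u && [forall a, A (inst u a) t]).
have key : d <= \sum_u g u.
  have le1 t : dens R (A^~ t) <= d +
      \sum_(u : W) (variable u && [forall a, A (inst u a) t])%:R.
    have [dt|/ltW dt] := leP d (dens R (A^~ t)); last first.
      by apply: le_trans dt _; rewrite lerDl sumr_ge0.
    have /existsNP[u /not_implyP[vu /contrapT uA]] := HI _ dt.
    rewrite (bigD1 u) //= vu /=.
    have -> : [forall a, A (inst u a) t] by apply/forallP.
    have h1 : 0 <= \sum_(i | i != u)
       (variable i && [forall a, A (inst i a) t])%:R :> R by rewrite sumr_ge0.
    have := @dens_le1 R _ (A^~ t) X0'; rewrite /=; lra.
  have := ler_avg le1; rewrite avgD avg_cst // avg_sum exchange_avg.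
  move: dA; rewrite -/(dens R _) exchange_avg mulr2n /g /dens; lra.
have [u gu] : exists u, d / #|W|%:R <= g u.
  by apply: avg_attained => //; rewrite ler_pM2r ?invr_gt0 ?ltr0n.
have gu0 : 0 < g u by apply: lt_le_trans gu; rewrite divr_gt0 ?ltr0n.
exists u; first by have [t /andP[]] := dens_attained gu0.
by apply: le_trans gu _; apply: le_dens => t /andP[].
Qed.

(** Subspaces instead of lines, one parameter at a time: a line popular in the
    first block leaves a dense set of continuations in the second one. *)
Lemma DHJ_subspace X : (0 < #|X|)%N -> DHJ X ->
  forall m (d : R), 0 < d -> exists I, forall A : pred {ffun I -> X},
    d <= dens R A -> exists2 w : {ffun I -> X + 'I_m}, wide w &
      forall x, A (app w x).
Proof.
move=> X0 HX; elim=> [|m IHm] d d0.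
  exists unit => A dA; have [|x Ax] := @dens_attained R _ A.
    exact: lt_le_trans dA.
  exists [ffun i => inl (x i)] => [[]//|y].
  by rewrite (_ : app _ _ = x) //; apply/ffunP => i; rewrite !ffunE.
have d20 : 0 < d / 2 by rewrite divr_gt0.
have [I1 HI1] := HX _ d20.
have W0 : (0 < #|{ffun I1 -> option X}|)%N by apply/card_word_gt0/card_opt_gt0.
have [|I2 HI2] := IHm (d / 2 / #|{ffun I1 -> option X}|%:R).
  by rewrite divr_gt0 ?ltr0n.
exists (I1 + I2)%type => A dA.
have [|u /existsP[i /eqP ui] uA] := @forces_line_popular X (d / 2) I1
    {ffun I2 -> X} (fun x y => A (join x y)) X0 (card_word_gt0 _ X0) d20 HI1.
  by move: dA; rewrite /dens avg_join mulr2n; lra.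
have [w ww wA] := HI2 _ uA.
exists [ffun k => match k with
  | inl i => if u i is Some a then inl a else inr ord0
  | inr j => match w j with inl a => inl a | inr s => inr (lift ord0 s) end end].
  move=> s; have [s'|] := unliftP ord0 s.
    by move=> ->; have [j wj] := ww s'; exists (inr j); rewrite ffunE wj.
  by move=> ->; exists (inl i); rewrite ffunE ui.
move=> x; have /forallP/(_ (x ord0)) := wA [ffun s => x (lift ord0 s)].
congr (A _); apply/ffunP => -[k|k]; rewrite !ffunE; first by case: (u k).
by case: (w k) => // s; rewrite ffunE.
Qed.

Lemma DHJ_subspace_fin X S : (0 < #|X|)%N -> DHJ X ->
  forall (d : R), 0 < d -> exists I, forall A : pred {ffun I -> X},
    d <= dens R A -> exists2 w : {ffun I -> X + S}, wide w &
      forall x, A (app w x).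
Proof.
move=> X0 HX d d0; have [I HI] := DHJ_subspace X0 HX #|S| d0.
exists I => A /HI[w ww wA].
exists [ffun i => match w i with inl a => inl a | inr s => inr (enum_val s) end].
  move=> s; have [i wi] := ww (enum_rank s).
  by exists i; rewrite ffunE wi enum_rankK.
move=> x; have := wA [ffun s => x (enum_val s)]; congr (A _).
by apply/ffunP => i; rewrite !ffunE; case: (w i) => // s; rewrite ffunE.
Qed.

End DenseLines.

(** * Subspaces in insensitive sets *)

Section Tiling.
Variable R : realType.
Implicit Types I J S T X Y : finType.

Lemma small_power (q c : R) : 0 <= q < 1 -> 0 < c -> exists n, q ^+ n <= c.
Proof.
move=> /andP[q0 q1] c0.
have [->|qn0] := eqVneq q 0; first by exists 1%N; rewrite expr1 ltW.
have q_gt0 : 0 < q by rewrite lt_def qn0.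
pose h := q^-1 - 1.
have h0 : 0 < h by rewrite subr_gt0 invf_gt1.
have qE : q^-1 = 1 + h by rewrite /h; ring.
have bern n : 1 + n%:R * h <= q^-1 ^+ n.
  rewrite qE; elim: n => [|n IHn]; first by rewrite mul0r addr0 expr0.
  have hn : 0 <= n%:R * h * h by rewrite !mulr_ge0 ?ler0n ?(ltW h0).
  have : (1 + h) * (1 + n%:R * h) <= (1 + h) * (1 + h) ^+ n.
    by apply: ler_wpM2l => //; apply: addr_ge0 => //; exact: ltW.
  rewrite exprS -natr1; lra.
have [n hn] : exists n : nat, c^-1 <= n%:R * h.
  exists (Num.bound (c^-1 / h)); rewrite -ler_pdivrMr //.
  by rewrite ltW // archi_boundP // divr_ge0 ?invr_ge0 ?(ltW c0) ?(ltW h0).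
exists n; rewrite -[q]invrK exprVn invf_ple ?posrE ?exprn_gt0 ?invr_gt0 //.
by apply: le_trans (bern n); apply: le_trans hn _; rewrite lerDr.
Qed.

(** Resampling part of a uniformly random object does not change its law. The
    pair (phi, psi) exchanges the resampled part of x with z. *)
Lemma avg_resample S T (phi : S -> T -> S) (psi : S -> T -> T) (G : S -> R) :
  (0 < #|T|)%N ->
  (forall x z, phi (phi x z) (psi x z) = x) ->
  (forall x z, psi (phi x z) (psi x z) = z) ->
  avg G = avg (fun x => avg (fun z => G (phi x z))).
Proof.
move=> T0 phiK psiK.
rewrite (eq_avg (g := fun x => avg (fun _ : T => G x))) => [|x].
  rewrite -(avg_pair (fun p : S * T => G p.1)).
  rewrite -(avg_pair (fun p : S * T => G (phi p.1 p.2))).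
  rewrite (@avg_bij _ _ _ (fun p : S * T => (phi p.1 p.2, psi p.1 p.2))) //.
  exists (fun p : S * T => (phi p.1 p.2, psi p.1 p.2)) => -[x z] /=;
    by rewrite phiK psiK.
by rewrite avg_cst.
Qed.

Lemma avg_image S T (h : S -> T) (g : T -> R) : (0 < #|S|)%N -> injective h ->
  avg (fun t => g t * [exists x, h x == t]%:R) =
  avg (fun x => g (h x)) * (#|S|%:R / #|T|%:R).
Proof.
move=> S0 hinj; have S0' : #|S|%:R != 0 :> R by rewrite pnatr_eq0 -lt0n.
rewrite /avg [RHS]mulrA mulfVK //; congr (_ / _).
have -> : \sum_x g (h x) = \sum_(t in h @: predT) g t.
  by rewrite big_imset //= => x y _ _ /hinj.
rewrite [RHS]big_mkcond; apply: eq_bigr => t _.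
have <- : (t \in h @: predT) = [exists x, h x == t].
  by apply/imsetP/existsP => [[x _ ->]|[x /eqP<-]]; exists x.
by case: (t \in _); rewrite ?mulr1 ?mulr0.
Qed.


(** A set of words over option X of the form E (inst y i) does not distinguish
    the letters None and i; such a set is called insensitive. If it is dense, it
    contains a subspace over the whole of option X. Indeed, condition on the
    positions of the letter None, which with high probability leave enough other
    positions. There y is a uniformly random word over X, so the theorem over X
    gives a subspace over X, and insensitivity extends it to the letter None. *)
Lemma insensitive_subspace X (i : X) S (e : R) : DHJ R X -> 0 < e ->
  exists I, forall E : pred {ffun I -> X},
    e <= dens R (fun y : {ffun I -> option X} => E (inst y i)) ->
    exists2 w : {ffun I -> option X + S}, wide w &
      forall x, E (inst (app w x) i).
Proof.
move=> HX e0; have X0 : (0 < #|X|)%N by apply/card_gt0P; exists i.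
have e40 : 0 < e / 4 by rewrite divr_gt0.
have [I1 HI1] := DHJ_subspace_fin S X0 HX e40.
set n1 := #|I1|.
(* F turns the number of letters other than None into an exponential moment *)
pose F (y : option X) : R := if y is Some _ then 2^-1 else 1.
have F01 : 0 <= avg F < 1.
  rewrite avg_ge0 => [|[x|]//] /=; last by rewrite invr_ge0.
  rewrite /avg ltr_pdivrMr ?mul1r ?ltr0n ?card_opt_gt0 //.
  rewrite (_ : #|_|%:R = \sum_(y : option X) 1); last by rewrite sumr_const.
  rewrite (bigD1 (Some i)) //= [X in _ < X](bigD1 (Some i)) //=.
  apply: ltr_leD; first by rewrite /F; lra.
  by apply: ler_sum => -[x|] _; rewrite /F; lra.
have c0 : 0 < e / 4 / 2 ^+ n1 by rewrite divr_gt0 ?exprn_gt0.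
have [L FL] := small_power F01 c0.
exists 'I_L => E dE.
pose Y := {ffun 'I_L -> option X}.
have Y0 : (0 < #|{: Y}|)%N by apply/card_word_gt0/card_opt_gt0.
pose free (y : Y) := [set j | y j != None].
pose mix (y : Y) (x : {ffun 'I_L -> X}) : Y :=
  [ffun j => if y j is Some _ then Some (x j) else None].
have few : dens R (fun y => #|free y| < n1)%N <= e / 4.
  have few1 (y : Y) : ((#|free y| < n1)%N%:R : R) <= 2 ^+ n1 * \prod_j F (y j).
    have -> : \prod_j F (y j) = 2^-1 ^+ #|free y|.
      rewrite -prodr_const [RHS]big_mkcond; apply: eq_bigr => j _.
      by rewrite inE /F; case: (y j).
    case: ltnP => [lt|_]; last by rewrite mulr_ge0 ?exprn_ge0 ?invr_ge0.
    by rewrite exprVn -expfB // exprn_ege1 // ler1n.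
  apply: le_trans (ler_avg few1) _; rewrite avgZ (@avg_prod _ _ _ (fun=> F)) prodr_const card_ord.
  by rewrite mulrC -ler_pdivlMr ?exprn_gt0.
have [y [fy dy]] : exists y : Y, (n1 <= #|free y|)%N /\
    e / 2 <= dens R (fun x => E (inst (mix y x) i)).
  have dE' : e <= avg (fun y => dens R (fun x => E (inst (mix y x) i))).
    rewrite /dens -(@avg_resample _ _ mix
      (fun y x => [ffun j => odflt (x j) (y j)]) (fun y => (E (inst y i))%:R)) //.
    - exact: card_word_gt0.
    - move=> y x; apply/ffunP => j; rewrite !ffunE.
      by case E': (y j) => [a|] /=; rewrite ?E'.
    - move=> y x; apply/ffunP => j; rewrite !ffunE.
      by case E': (y j) => [a|] /=; rewrite ?E'.
  have [y] := @avg_attained R _ (fun y => dens R (fun x => E (inst (mix y x) i))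
     - (#|free y| < n1)%N%:R) (e / 2) Y0 ltac:(rewrite avgB; move: few; rewrite /dens; lra).
  have := @dens_le1 R _ (fun x => E (inst (mix y x) i)) (card_word_gt0 _ X0).
  case: ltnP => [_|fy] h1 /= h2; first by exfalso; lra.
  by exists y; split=> //; lra.
(* I1 is embedded into the free positions; all others are frozen *)
pose emb (t : I1) : 'I_L := enum_val (widen_ord fy (enum_rank t)).
have embI : injective emb.
  by move=> s t /enum_val_inj /(congr1 val) /= /val_inj /enum_rank_inj.
have yemb t : y (emb t) != None.
  by have := enum_valP (widen_ord fy (enum_rank t)); rewrite inE.
pose ov (x : {ffun 'I_L -> X}) (x1 : {ffun I1 -> X}) : {ffun 'I_L -> X} :=
  [ffun j => if [pick t | emb t == j] is Some t then x1 t else x j].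
have pick_emb t : [pick t' | emb t' == emb t] = Some t.
  by case: pickP => [t' /eqP/embI->|/(_ t)]; rewrite ?eqxx.
have [x dx] : exists x, e / 4 <= dens R (fun x1 => E (inst (mix y (ov x x1)) i)).
  apply: avg_attained; first exact: card_word_gt0.
  rewrite /dens -(@avg_resample _ _ ov (fun x _ => [ffun t => x (emb t)])
    (fun x => (E (inst (mix y x) i))%:R)).
  - by move: dy; rewrite /dens; lra.
  - exact: card_word_gt0.
  - move=> x x1; apply/ffunP => j; rewrite !ffunE.
    by case: pickP => [t /eqP<-|//]; rewrite ffunE.
  - by move=> x x1; apply/ffunP => t; rewrite !ffunE pick_emb.
have [w1 ww1 w1E] := HI1 _ dx.
exists [ffun j => if y j is None then inl None else
  if [pick t | emb t == j] is Some t then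
    match w1 t with inl a => inl (Some a) | inr s => inr s end
  else inl (Some (x j))].
  move=> s; have [t wt] := ww1 s; exists (emb t).
  by rewrite ffunE pick_emb wt; case: (y _) (yemb t).
move=> z; have := w1E (inst z i); congr (E _); apply/ffunP => j; rewrite !ffunE.
case: (y j) => [a|//] /=; case: pickP => [t _|//]; rewrite ffunE.
by case: (w1 t) => // s; rewrite ffunE.
Qed.

End Tiling.

(** * Tiling intersections of insensitive sets *)

Section Increment.
Variable R : realType.
Implicit Types I J S T X Y : finType.

Definition bounded_on_subspaces J S Y (eta : R) (f : {ffun J -> Y} -> R) :=
  forall w : {ffun J -> Y + S}, wide w -> avg (fun x => f (app w x)) <= eta.

(** An insensitive set is almost a disjoint union of subspaces, so a function with
    averages at most eta on all subspaces has average at most about eta on the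
    set. The words are cut into r blocks I. As long as the set has density above
    e, a fixed proportion of its fibres along the first block is dense enough to
    contain a subspace; removing one from each lowers the density by a constant.
    The subspace is chosen as a function of the fibre, which depends on the later
    blocks only through inst y i, so the rest remains insensitive in the later
    blocks; the first block joins the parameters P. *)
Lemma greedy_tiling X (i : X) S (e eta : R) I :
  0 < e -> 0 <= eta ->
  (forall E : pred {ffun I -> X},
    e / 2 <= dens R (fun y : {ffun I -> option X} => E (inst y i)) ->
    exists2 w : {ffun I -> option X + S}, wide w &
      forall x, E (inst (app w x) i)) ->
  forall (r : nat) (P : finType)
    (E : P -> pred {ffun iter r (fun J => I + J)%type void -> X})
    (f : P -> {ffun iter r (fun J => I + J)%type void -> option X} -> R),
  (0 < #|P|)%N ->
  (forall p y, f p y <= 1) ->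
  (forall p, bounded_on_subspaces S eta (f p)) ->
  let D := avg (fun p => avg (fun y => (E p (inst y i))%:R)) in
  D <= e + r%:R * (e / 2 / #|{ffun I -> option X}|%:R) ->
  avg (fun p => avg (fun y => f p y * (E p (inst y i))%:R)) <= eta * D + e.
Proof.
move=> e0 eta0 HI.
have X0 : (0 < #|X|)%N by apply/card_gt0P; exists i.
have Y0 J : (0 < #|{ffun J -> option X}|)%N by apply/card_word_gt0/card_opt_gt0.
have small (J P : finType) (E : P -> pred {ffun J -> X})
    (f : P -> {ffun J -> option X} -> R) :
    (forall p y, f p y <= 1) ->
    let D := avg (fun p => avg (fun y => (E p (inst y i))%:R)) in D <= e ->
    avg (fun p => avg (fun y => f p y * (E p (inst y i))%:R)) <= eta * D + e.
  move=> f1 D De; apply: (@le_trans _ _ D).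
    apply: ler_avg => p; apply: ler_avg => y.
    by rewrite -[leRHS]mul1r ler_wpM2r ?ler0n.
  have : 0 <= D by apply: avg_ge0 => p; apply: avg_ge0 => y; rewrite ler0n.
  by move=> D0; have := mulr_ge0 eta0 D0; lra.
elim=> [|r IHr] P E f P0 f1 fw D; first by rewrite mul0r addr0; apply: small.
set k := e / 2 / _ => Dr.
have [De|De] := leP D e; first exact: small.
rewrite /= in E f f1 fw D Dr De *.
set J := iter r _ _ in E f f1 fw D Dr De *.
pose Y := {ffun I -> option X}.
(* the subspace removed from the fibre over the parameter and the later blocks *)
have /choice[V VP] (pz : P * {ffun J -> X}) :
    exists o : option {ffun I -> option X + S},
    if o is Some w
    then wide w /\ forall x, E pz.1 (join (inst (app w x) i) pz.2)
    else dens R (fun y : Y => E pz.1 (join (inst y i) pz.2)) < e / 2.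
  have [dE|dE] := leP (e / 2)
    (dens R (fun y : Y => E pz.1 (join (inst y i) pz.2))); last by exists None.
  by have [w ww wE] := HI (fun x => E pz.1 (join x pz.2)) dE; exists (Some w).
pose rem p z (y1 : Y) :=
  if V (p, z) is Some w then [exists x, app w x == y1] else false.
have remE p z y1 : rem p z y1 -> E p (join (inst y1 i) z).
  rewrite /rem; have := VP (p, z); case: (V _) => // w [_ wE] /existsP[x /eqP<-].
  exact: wE.
pose E' (q : P * Y) : pred {ffun J -> X} :=
  fun z => E q.1 (join (inst q.2 i) z) && ~~ rem q.1 z q.2.
pose f' (q : P * Y) (y2 : {ffun J -> option X}) := f q.1 (join q.2 y2).
have split p (y1 : Y) (y2 : {ffun J -> option X}) :
    (E p (join (inst y1 i) (inst y2 i)))%:R =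
    (E' (p, y1) (inst y2 i))%:R + (rem p (inst y2 i) y1)%:R :> R.
  rewrite /E' /=; have := @remE p (inst y2 i) y1.
  by case: (rem _ _ _) => [->//|_] /=; rewrite ?andbF ?andbT ?add0r ?addr0.
pose D' := avg (fun q => avg (fun y => (E' q (inst y i))%:R : R)).
pose Rm := avg (fun p => avg (fun y2 : {ffun J -> option X} =>
  avg (fun y1 => (rem p (inst y2 i) y1)%:R : R))).
have DE : D = D' + Rm.
  rewrite /D /D' avg_pair /Rm -avgD; apply: eq_avg => p.
  rewrite avg_join -[X in _ = _ + X]exchange_avg -avgD.
  apply: eq_avg => y1; rewrite -avgD; apply: eq_avg => y2.
  by rewrite inst_join split.
have fE : avg (fun p => avg (fun y => f p y * (E p (inst y i))%:R)) =
   avg (fun q => avg (fun y => f' q y * (E' q (inst y i))%:R)) +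
   avg (fun p => avg (fun y2 => avg (fun y1 =>
     f p (join y1 y2) * (rem p (inst y2 i) y1)%:R))).
  rewrite avg_pair -avgD; apply: eq_avg => p.
  rewrite avg_join -[X in _ = _ + X]exchange_avg -avgD.
  apply: eq_avg => y1; rewrite -avgD; apply: eq_avg => y2.
  by rewrite inst_join split mulrDr.
have PY0 : (0 < #|{: P * Y}|)%N by rewrite card_prod muln_gt0 P0 Y0.
have removed : avg (fun p => avg (fun y2 => avg (fun y1 =>
     f p (join y1 y2) * (rem p (inst y2 i) y1)%:R))) <= eta * Rm.
  rewrite /Rm -avgZ; apply: ler_avg => p; rewrite -avgZ; apply: ler_avg => y2.
  rewrite /rem; have := VP (p, inst y2 i); case: (V _) => [w [ww _]|_]; last first.
    by rewrite -avgZ; apply: ler_avg => y1; rewrite !mulr0.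
  have := @avg_image R _ _ _ (fun=> 1) (Y0 S) (app_inj ww).
  rewrite avg_cst // (eq_avg (g := fun y1 => [exists x, app w x == y1]%:R)) => [->|y1];
    last by rewrite mul1r.
  rewrite (@avg_image R _ _ _ (fun y1 => f p (join y1 y2)) (Y0 S) (app_inj ww)).
  rewrite mul1r ler_wpM2r ?divr_ge0 ?ler0n //.
  pose w' : {ffun I + J -> option X + S} :=
    [ffun k => match k with inl j => w j | inr j => inl (y2 j) end].
  have ww' : wide w' by move=> s; have [j wj] := ww s; exists (inl j); rewrite ffunE.
  rewrite (eq_avg (g := fun x => f p (app w' x))); first exact: fw.
  by move=> x; congr (f p _); apply/ffunP => -[j|j]; rewrite !ffunE.
have Rmk : k <= Rm.
  pose b p z : R := if V (p, z) is Some _ then 1 else 0.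
  have bD : D <= avg (fun p => avg (fun y2 : {ffun J -> option X} =>
      b p (inst y2 i))) + e / 2.
    rewrite -[X in _ + X](avg_cst (T := P)) // -avgD; apply: ler_avg => p.
    apply: (@le_trans _ _ (avg (fun y2 : {ffun J -> option X} =>
      b p (inst y2 i) + e / 2))); last by rewrite avgD avg_cst ?Y0.
    rewrite avg_join exchange_avg; apply: ler_avg => y2.
    rewrite /b; have := VP (p, inst y2 i); case: (V _) => [w _|/ltW].
      apply: avg_le_cst => // y1; apply: (@le_trans _ _ 1); last lra.
      by rewrite lern1 leq_b1.
    rewrite add0r; apply: le_trans; apply: ler_avg => y1.
    by rewrite inst_join.
  apply: (@le_trans _ _ (avg (fun p => avg (fun y2 : {ffun J -> option X} =>
      b p (inst y2 i))) * #|{: Y}|%:R^-1)).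
    by rewrite /k ler_pM2r ?invr_gt0 ?ltr0n //; lra.
  rewrite mulrC /Rm -avgZ; apply: ler_avg => p; rewrite -avgZ.
  apply: ler_avg => y2; rewrite /b /rem.
  have := VP (p, inst y2 i); case: (V _) => [w [ww _]|_]; last first.
    by rewrite mulr0; apply: avg_ge0.
  have := @avg_image R _ _ _ (fun=> 1) (Y0 S) (app_inj ww).
  rewrite avg_cst // (eq_avg (g := fun y1 => [exists x, app w x == y1]%:R)) => [->|y1];
    last by rewrite mul1r.
  by rewrite mulr1 mul1r -[leLHS]mul1r ler_wpM2r ?invr_ge0 ?ler0n ?ler1n ?Y0.
have := IHr _ E' f' PY0 (fun _ _ => f1 _ _) _.
rewrite -/D' fE => IH.
have : avg (fun q => avg (fun y => f' q y * (E' q (inst y i))%:R)) <= eta * D' + e.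
  apply: IH.
    move=> [p y1] w ww.
    pose w' : {ffun I + J -> option X + S} :=
      [ffun k => match k with inl j => inl (y1 j) | inr j => w j end].
    have ww' : wide w' by move=> s; have [j wj] := ww s; exists (inr j); rewrite ffunE.
    rewrite (eq_avg (g := fun x => f p (app w' x))); first exact: fw.
    by move=> x; congr (f p _); apply/ffunP => -[j|j]; rewrite !ffunE.
  by rewrite -/k; move: Dr; rewrite DE -natr1 mulrDl mul1r; lra.
by rewrite DE; lra.
Qed.

(** Enough blocks for the density to have dropped below e. *)
Lemma one_insensitive X (i : X) S (e : R) : DHJ R X -> 0 < e ->
  exists J, forall (E : pred {ffun J -> X}) (f : {ffun J -> option X} -> R) eta,
    0 <= eta -> (forall y, f y <= 1) -> bounded_on_subspaces S eta f ->
    avg (fun y => f y * (E (inst y i))%:R) <= eta + e.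
Proof.
move=> HX e0; have e20 : 0 < e / 2 by rewrite divr_gt0.
have [I HI] := insensitive_subspace i S HX e20.
have Y0 J : (0 < #|{ffun J -> option X}|)%N by apply/card_word_gt0/card_opt_gt0.
set k := e / 2 / #|{ffun I -> option X}|%:R.
have k0 : 0 < k by rewrite divr_gt0 ?ltr0n.
pose r := Num.bound k^-1.
exists (iter r (fun J => I + J)%type void) => E f eta eta0 f1 fw.
have := @greedy_tiling X i S e eta I e0 eta0 HI r unit (fun=> E) (fun=> f).
rewrite card_unit !avg_cst ?card_unit // => /(_ isT (fun=> f1) (fun=> fw)).
have D1 : dens R (fun y => E (inst y i)) <= 1 by apply: dens_le1.
have rk : 1 <= r%:R * k.
  by rewrite -ler_pdivrMr // div1r ltW // archi_boundP // invr_ge0 ltW.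
rewrite -/(dens R (fun y => E (inst y i))) => /(_ ltac:(rewrite -/k; lra)) H.
by apply: le_trans H _; rewrite lerD2r -[leRHS]mulr1 ler_wpM2l.
Qed.

(** Intersections of insensitive sets, one for each letter of a list: tile the
    intersection of all but the first by subspaces, in each of which the first
    is again insensitive. *)
Lemma many_insensitive X (l : seq X) S (e : R) : DHJ R X -> 0 < e ->
  exists J, forall (E : X -> pred {ffun J -> X}) (f : {ffun J -> option X} -> R) eta,
    0 <= eta -> (forall y, f y <= 1) -> bounded_on_subspaces S eta f ->
    avg (fun y => f y * (all (fun i => E i (inst y i)) l)%:R) <= eta + e.
Proof.
move=> HX; elim: l S e => [|i l IHl] S e e0.
  exists S => E f eta eta0 f1 fw; have := fw [ffun s => inr s].
  rewrite (eq_avg (g := f)) => [H|y]; last first.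
    by congr f; apply/ffunP => s; rewrite !ffunE.
  rewrite (eq_avg (g := f)) => [|y]; last by rewrite mulr1.
  by have := H ltac:(by move=> s; exists s; rewrite ffunE); lra.
have e20 : 0 < e / 2 by rewrite divr_gt0.
have [M HM] := one_insensitive i S HX e20.
have [J HJ] := IHl M _ e20.
exists J => E f eta eta0 f1 fw.
pose g y := f y * (E i (inst y i))%:R.
rewrite (eq_avg (g := fun y => g y * (all (fun i => E i (inst y i)) l)%:R)); last first.
  by move=> y /=; rewrite /g -mulrA -natrM mulnb.
have -> : eta + e = (eta + e / 2) + e / 2 by lra.
apply: HJ; first lra.
  move=> y; rewrite /g; case: (E _ _); rewrite ?mulr1 ?mulr0 ?f1 //.
move=> w ww; rewrite /g.
rewrite (eq_avg (g := fun x => f (app w x) *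
  (E i (app (mapl (odflt i) w) (inst x i)))%:R)); last by move=> x; rewrite inst_app.
apply: (HM (fun x => E i (app (mapl (odflt i) w) x))) => // v wv.
rewrite (eq_avg (g := fun x => f (app (comp w v) x))); last by move=> x; rewrite app_comp.
by apply: fw; apply: wide_comp.
Qed.

End Increment.

(** * The density Hales-Jewett theorem *)

Section Step.
Variable R : realType.
Implicit Types I J S T X Y : finType.

Lemma avg_near_max T (g : T -> R) (c d : R) :
  (0 < #|T|)%N -> (forall x, g x <= c) -> c - d <= avg g ->
  forall x, c - d * #|T|%:R <= g x.
Proof.
move=> T0 gc cd x; have T0' : 0 < #|T|%:R :> R by rewrite ltr0n.
have : c - g x <= (c - avg g) * #|T|%:R.
  rewrite -{2}(avg_cst c T0) -avgB /avg mulfVK ?gt_eqF //.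
  rewrite (bigD1 x) //= lerDl sumr_ge0 // => y _; rewrite subr_ge0; exact: gc.
have : (c - avg g) * #|T|%:R <= d * #|T|%:R by rewrite ler_pM2r //; lra.
lra.
Qed.

Definition no_new S X (x : {ffun S -> option X}) : bool :=
  [forall s, x s != None].

Lemma no_new_rare X (e : R) : (0 < #|X|)%N -> 0 < e -> exists n, forall S,
  (n <= #|S|)%N -> dens R (@no_new S X) <= e.
Proof.
move=> X0 e0; pose F (y : option X) : R := (y != None)%:R.
have F01 : 0 <= avg F < 1.
  rewrite avg_ge0 => [|y]; last by rewrite ler0n.
  rewrite /avg ltr_pdivrMr ?mul1r ?ltr0n ?card_opt_gt0 //.
  rewrite (_ : #|_|%:R = \sum_(y : option X) 1); last by rewrite sumr_const.
  rewrite (bigD1 None) //= [X in _ < X](bigD1 None) //=.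
  apply: ltr_leD; first by rewrite /F /=; lra.
  by apply: ler_sum => y _; rewrite lern1 leq_b1.
have [n Fn] := small_power F01 e0; exists n => S nS.
apply: le_trans Fn; rewrite /dens.
rewrite (eq_avg (g := fun x : {ffun S -> option X} => \prod_s F (x s))).
  rewrite (@avg_prod _ _ _ (fun=> F)) prodr_const.
  have [F0 F1] := andP F01; rewrite cardE -cardE.
  by apply: ler_wiXn2l => //; exact: ltW.
move=> x; rewrite /no_new; case: (boolP [forall _, _]) => [/forallP xs|].
  by rewrite big1 // => s _; rewrite /F xs.
by rewrite negb_forall => /existsP[s xs]; rewrite (bigD1 s) //= /F (negbTE xs) mul0r.
Qed.

(** The critical density al is the infimum of the densities that force a line in
    some dimension. *)
Lemma critical_density X : (0 < #|X|)%N -> DHJ R X \/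
  exists al : R, [/\ 0 < al, al <= 1,
    forall g, 0 < g -> exists I, forall A : pred {ffun I -> X},
      line_free A -> dens R A <= al + g &
    forall g I, 0 < g -> exists A : pred {ffun I -> X},
      line_free A /\ al - g <= dens R A].
Proof.
move=> X0; have W0 J := @card_word_gt0 J X X0.
have [x0 _] := card_gt0P X0.
pose H : set R := [set d | exists I, forces_line X d I]%classic.
have H2 : H 2 by exists void => A; have := @dens_le1 R _ A (W0 _); lra.
have H_ge0 : lbound H 0.
  move=> d [I HI]; rewrite leNgt; apply/negP => d0.
  apply: (HI pred0) => [|u _ /(_ x0)//].
  by rewrite (le_trans (ltW d0)) // dens_ge0.
have Hinf : has_inf H by split; [exists 2|exists 0].
pose al : R := inf H.
have upper (g : R) : 0 < g -> exists I, forall A : pred {ffun I -> X},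
    line_free A -> dens R A <= al + g.
  move=> g0; have [d [I HI] dg] := inf_adherent g0 Hinf.
  exists I => A lfA; rewrite leNgt; apply/negP => Ag.
  by apply: HI lfA; apply: ltW; apply: lt_trans Ag.
have lower (g : R) I : 0 < g -> exists A : pred {ffun I -> X},
    line_free A /\ al - g <= dens R A.
  move=> g0; apply: contrapT => /forallNP NA.
  have : H (al - g) by exists I => A dA lfA; apply: (NA A).
  by move/(ge_inf (proj2 Hinf)); rewrite -/al; lra.
have [al0|al_gt0] := leP al 0; [left|right].
  move=> d d0; have [I HI] := upper _ (divr_gt0 d0 (ltr0Sn _ 1)).
  by exists I => A dA /HI; lra.
exists al; split=> //; apply/ler_addgt0Pr => g g0.
have [A [_ dA]] := lower g void g0.
by have := @dens_le1 R _ A (W0 _); lra.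
Qed.

(** The cube over option X which a wildcard t0 of the line u opens in a random
    pattern a. *)
Definition fill T J X (u : {ffun T -> option X}) (t0 : T)
    (a : {ffun T * J -> option X}) (x : {ffun J -> option X}) :
    {ffun T * J -> option X} :=
  [ffun k => if k.1 == t0 then x k.2 else
             if a k is Some b then Some b else u k.1].

Definition old I X (x : {ffun I -> X}) : {ffun I -> option X} :=
  [ffun i => Some (x i)].

(** Completing the new letters of a random pattern a, block by block, by a word
    of X^T embeds X^T among the words without new letters. Averaging the
    theorem over X over these embeddings gives a line u of X^T which is good
    for a positive proportion of the patterns. At a wildcard t0 of u, block t0
    of the completed pattern is the uniformly random block t0 of a itself:
    this is what makes the good event dense in a whole cube over option X,
    and the proportion does not depend on J. *)
Lemma popular_fill X T J (Om : finType) (d : R)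
    (A : {ffun T * J -> option X} -> Om -> bool) :
  (0 < #|X|)%N -> (0 < #|Om|)%N -> 0 < d -> forces_line X d T ->
  (forall z, d *+ 2 <= dens R (A z)) ->
  exists (u : {ffun T -> option X}) (t0 : T), u t0 = None /\
    d / #|{ffun T -> option X}|%:R <=
    avg (fun q : {ffun T * J -> option X} * Om => dens R (fun x =>
      [forall i, A (old (inst (fill u t0 q.1 x) i)) q.2])).
Proof.
move=> X0 Om0 d0 HT dA; pose W : finType := {ffun T * J -> option X}.
have W0 : (0 < #|W|)%N by apply/card_word_gt0/card_opt_gt0.
pose U (a : W) (x : {ffun T -> X}) : W :=
  [ffun k => Some (odflt (x k.1) (a k))].
have WO0 : (0 < #|{: W * Om}|)%N by rewrite card_prod muln_gt0 W0.
have [|u /existsP[t0 /eqP ut0] uc] := @forces_line_popular R X d T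
    (W * Om)%type (fun x q => A (U q.1 x) q.2) X0 WO0 d0 HT.
  apply: avg_ge_cst => [|x]; first exact: card_word_gt0.
  by rewrite avg_pair; apply: avg_ge_cst => // a; exact: (dA (U a x)).
exists u, t0; split=> //; apply: le_trans uc _; rewrite /dens !avg_pair /=.
pose upd (a : W) (x : {ffun J -> option X}) : W :=
  [ffun k => if k.1 == t0 then x k.2 else a k].
rewrite (@avg_resample R _ _ upd (fun a _ => [ffun j => a (t0, j)])).
- apply: ler_avg => a; rewrite exchange_avg; apply: ler_avg => y.
  apply: ler_avg => x; rewrite ler_nat.
  case: (boolP [forall _, _]) => // /forallP h.
  rewrite (_ : [forall _, _] = true) //; apply/forallP => i.
  move: (h i); congr (A _ y); apply/ffunP => -[t j]; rewrite !ffunE /=.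
  by case: eqP => [->|_]; rewrite ?ut0 //; case: (a _).
- exact/card_word_gt0/card_opt_gt0.
- move=> a x; apply/ffunP => -[t j]; rewrite !ffunE /=.
  by case: eqP => [->|]; rewrite ?ffunE.
- by move=> a x; apply/ffunP => j; rewrite !ffunE eqxx.
Qed.

Lemma line_free_fill X T J I (A : pred {ffun T * J + I -> option X}) u t0 a y :
  line_free A -> line_free (fun x => A (join (fill u t0 a x) y)).
Proof.
move=> lfA.
pose w : {ffun (T * J) + I -> option X + J} := [ffun k => match k with
  | inl k => if k.1 == t0 then inr k.2 else
             if a k is Some b then inl (Some b) else inl (u k.1)
  | inr j => inl (y j) end].
have ww : wide w by move=> j; exists (inl (t0, j)); rewrite ffunE eqxx.
move=> v vv vB; apply: (line_free_app ww lfA vv) => i.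
move: (vB i); congr (A _); apply/ffunP => -[[t j]|j]; rewrite !ffunE //=.
by case: ifP => _; [rewrite ffunE|case: (a _)].
Qed.

(** A word containing a new letter completes the line through the words
    obtained by substituting the letters of X for the new one. *)
Lemma line_free_complete X T J I (A : pred {ffun T * J + I -> option X})
    u t0 a y x : line_free A -> A (join (fill u t0 a x) y) ->
  (forall i, A (join (old (inst (fill u t0 a x) i)) y)) -> no_new x.
Proof.
move=> lfA Ax Ai; apply/forallP => j; apply/eqP => xj.
set z := fill u t0 a x in Ax Ai.
pose v : {ffun T * J -> option (option X)} :=
  [ffun k => if z k is Some b then Some (Some b) else None].
apply: (lfA (join v (old y))).
  by apply/existsP; exists (inl (t0, j)); rewrite !ffunE /= eqxx xj.
have y_inst b : inst (old y) b = y by apply/ffunP => k; rewrite !ffunE.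
have vE b k : inst v b k = if z k is Some c then Some c else b.
  by rewrite ffunE [v k]ffunE; case: (z k).
move=> [i|]; rewrite inst_join y_inst.
  move: (Ai i); congr (A (join _ y)); apply/ffunP => k.
  by rewrite vE [LHS]ffunE [in LHS]ffunE; case: (z k).
move: Ax; congr (A (join _ y)); apply/ffunP => k.
by rewrite vE; case: (z k).
Qed.

(** If B is not denser than al on any intersection of insensitive sets, then
    neither is it on the complement of one such intersection D, since this
    complement is a disjoint union of boundedly many others. So if B nearly
    misses D, then B is less dense than al by about al times the density of D. *)
Lemma avoid_intersection X J (B : pred {ffun J -> option X})
    (E : X -> pred {ffun J -> X}) (al e : R) : (0 < #|X|)%N -> 0 <= e ->
  let D := fun x => [forall i, E i (inst x i)] in
  (forall F : X -> pred {ffun J -> X},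
    avg (fun x => ((B x)%:R - al) *
      (all (fun i => F i (inst x i)) (enum X))%:R) <= e) ->
  dens R (fun x => B x && D x) <= e ->
  dens R B <= al * (1 - dens R D) + (#|{ffun X -> bool}|%:R + 1) * e.
Proof.
move=> X0 e0 D sparse BDe.
have Y0 : (0 < #|{ffun J -> option X}|)%N by apply/card_word_gt0/card_opt_gt0.
pose f x : R := (B x)%:R - al.
have DcE x : f x * (1 - (D x)%:R) =
    \sum_(s : {ffun X -> bool} | s != [ffun=> true])
      f x * (all (fun i => E i (inst x i) == s i) (enum X))%:R.
  rewrite -mulr_sumr; congr (_ * _).
  pose sx : {ffun X -> bool} := [ffun i => E i (inst x i)].
  have allE (s : {ffun X -> bool}) :
      all (fun i => E i (inst x i) == s i) (enum X) = (sx == s).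
    apply/allP/eqP => [h|<- i _]; last by rewrite ffunE.
    by apply/ffunP => i; rewrite ffunE; apply/eqP/h; rewrite mem_enum.
  have -> : D x = (sx == [ffun=> true]).
    apply/forallP/eqP => [h|/ffunP h i]; last by have := h i; rewrite !ffunE.
    by apply/ffunP => i; rewrite !ffunE h.
  have [sT|sT] := eqVneq sx [ffun=> true].
    rewrite subrr big1 // => s sn; rewrite allE sT.
    by rewrite eq_sym (negbTE sn).
  rewrite subr0 (bigD1 sx) //= allE eqxx big1 ?addr0 // => s /andP[_ sn].
  by rewrite allE eq_sym (negbTE sn).
have le_f : avg (fun x => f x * (1 - (D x)%:R)) <= #|{ffun X -> bool}|%:R * e.
  rewrite (eq_avg DcE) avg_sum.
  apply: (@le_trans _ _ (\sum_(s : {ffun X -> bool} | s != [ffun=> true]) e)).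
    by apply: ler_sum => s _; apply: (sparse (fun i z => E i z == s i)).
  have -> : #|{ffun X -> bool}|%:R * e = \sum_(s : {ffun X -> bool}) e.
    by rewrite sumr_const -[RHS]mulr_natl; congr (_%:R * _); apply: eq_card.
  by rewrite big_mkcond; apply: ler_sum => s _; case: ifP.
have -> : dens R B = dens R (fun x => B x && D x) + al * (1 - dens R D) +
    avg (fun x => f x * (1 - (D x)%:R)).
  rewrite -[X in al * (X - _)](avg_cst (T := {ffun J -> option X})) //.
  rewrite /dens -avgB -avgZ -!avgD; apply: eq_avg => x; rewrite /f.
  by case: (B x); case: (D x) => /=; ring.
lra.
Qed.

(** Let A be line-free of nearly critical density al. By extremality all its
    fibres over a bounded cube have density about al. A popular completed pattern
    yields a cube on which A induces B of density about al, and an intersection D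
    of insensitive sets of density at least c, which B avoids as A is line-free.
    By extremality again, B has density at most about al on each subspace, hence
    on each intersection of insensitive sets. Then B has density at most about
    al (1 - c), a contradiction. *)
Lemma DHJ_option X : (0 < #|X|)%N -> DHJ R X -> DHJ R (option X).
Proof.
move=> X0 HX; have Y0 J : (0 < #|{ffun J -> option X}|)%N.
  by apply/card_word_gt0/card_opt_gt0.
have [//|[al [al_gt0 al1 upper0 lower]]] := critical_density (card_opt_gt0 X).
exfalso.
have upper (g : R) r : 0 < g -> exists2 I : finType, (r <= #|I|)%N &
    forall A : pred {ffun I -> option X}, line_free A -> dens R A <= al + g.
  move=> /upper0[I HI]; exists ('I_r + I)%type.
    by rewrite card_sum card_ord leq_addr.
  move=> A lfA; rewrite /dens avg_join; apply: avg_le_cst => // x.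
  by apply: (HI (fun y => A (join x y))); apply: line_free_joinr.
have al40 : 0 < al / 4 by rewrite divr_gt0.
have [T HT] := HX _ al40.
(* c is half the density given by popular_fill; it depends on al only, whereas
   the dimensions S, J and I2 below depend on the error e *)
pose c : R := al / 4 / #|{ffun T -> option X}|%:R / 2.
pose K : R := #|{ffun X -> bool}|%:R.
have W1 : 1 <= #|{ffun T -> option X}|%:R :> R by rewrite ler1n.
have W0 : 0 < #|{ffun T -> option X}|%:R :> R by rewrite ltr0n.
have c0 : 0 < c by rewrite !divr_gt0.
have c1 : c <= 1 / 8.
  by rewrite /c ler_pdivrMr // ler_pdivrMr //; lra.
have K1 : 1 <= K by rewrite ler1n card_word_gt0 // card_bool.
have K0 : 0 < K by apply: lt_le_trans K1.
(* so small that the total error 3 e / c + 2 (K + 1) e stays below al c *)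
pose e : R := al * c ^+ 2 / (16 * K).
have alc2 : 0 < al * c ^+ 2 by rewrite mulr_gt0 ?exprn_gt0.
have e0 : 0 < e by apply: divr_gt0 => //; apply: mulr_gt0.
have eK : K * e = al * c ^+ 2 / 16 by rewrite /e; field; rewrite gt_eqF.
have eKe : e <= K * e by rewrite -[leLHS]mul1r ler_wpM2r // ltW.
have [n no_new_n] := no_new_rare X0 e0.
have [S nS HS] := upper e n e0.
have [J HJ] := many_insensitive (enum X) S HX e0.
pose W : finType := {ffun T * J -> option X}.
have Wgt0 : 0 < #|W|%:R :> R by rewrite ltr0n Y0.
pose g : R := e / 2 / #|W|%:R.
have g0 : 0 < g by do 2! apply: divr_gt0 => //.
have [I2 HI2] := upper0 g g0.
have [A [lfA dA]] := lower g (T * J + I2)%type g0.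
(* no fibre exceeds al + g in density, and their average is at least al - g *)
have fibre (x : W) : al - e <= dens R (fun y => A (join x y)).
  have := @avg_near_max _ (fun x : W => dens R (fun y => A (join x y)))
    (al + g) (2 * g) (Y0 _) _ _ x.
  have -> : 2 * g * #|W|%:R = e by rewrite /g; field; rewrite gt_eqF.
  move=> h; have {}h : al + g - e <= dens R (fun y => A (join x y)).
    apply: h => [z|]; first by apply: HI2; apply: line_free_joinr.
    by move: dA; rewrite {1}/dens avg_join; rewrite /dens; lra.
  lra.
have ale : al / 4 *+ 2 <= al - e.
  have c21 : c ^+ 2 <= 1 by rewrite expr_le1 //; lra.
  have : al * c ^+ 2 <= al by rewrite -[leRHS]mulr1 ler_wpM2l // ltW.
  by rewrite mulr2n; lra.
have [u [t0 [_ uc]]] := popular_fill X0 (Y0 I2) al40 HT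
  (fun z => le_trans ale (fibre z)).
pose B a y : pred {ffun J -> option X} := fun x => A (join (fill u t0 a x) y).
pose E a y (i : X) : pred {ffun J -> X} :=
  fun x => A (join (old (inst (fill u t0 a (old x)) i)) y).
pose D a y : pred {ffun J -> option X} := fun x => [forall i, E a y i (inst x i)].
have ED a y x i : E a y i (inst x i) = A (join (old (inst (fill u t0 a x) i)) y).
  rewrite /E; congr (A (join _ y)); apply/ffunP => k; rewrite !ffunE.
  by case: ifP; rewrite ?ffunE.
(* on each subspace with parameters S, B is line-free, so its density is at most
   al + e *)
have sparse a y (F : X -> pred {ffun J -> X}) :
    avg (fun x => ((B a y x)%:R - al) *
                  (all (fun i => F i (inst x i)) (enum X))%:R) <= 2 * e.
  have -> : 2 * e = e + e by rewrite mulr_natl mulr2n.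
  apply: (HJ F (fun x => (B a y x)%:R - al)) => [|x|w ww]; first exact: ltW.
    by rewrite lerBlDr (le_trans (y := 1)) ?lern1 ?leq_b1 // lerDl ltW.
  rewrite avgB avg_cst // lerBlDl.
  apply: (HS (fun x => B a y (app w x))); apply: line_free_app ww _.
  exact: line_free_fill.
have Bal a y : dens R (B a y) <= al + 2 * e.
  have := sparse a y (fun _ _ => true).
  rewrite (eq_avg (g := fun x => (B a y x)%:R - al)) => [|x].
    by rewrite avgB avg_cst // lerBlDl.
  by rewrite (_ : all _ _ = true) ?mulr1 //; apply/allP.
have BD a y : dens R (fun x => B a y x && D a y x) <= 2 * e.
  apply: (@le_trans _ _ (dens R (@no_new J X))).
    apply: le_dens => x /andP[Bx /forallP Dx]; apply: line_free_complete lfA Bx _.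
    by move=> i; rewrite -ED.
  have -> : 2 * e = e + e by rewrite mulr_natl mulr2n.
  have := HJ (fun _ _ => true) (fun x => (no_new x)%:R) e (ltW e0) _ _.
  rewrite (eq_avg (g := fun x => (no_new x)%:R)) => [H'|x]; last first.
    by rewrite (_ : all _ _ = true) ?mulr1 //; apply/allP.
  apply: H' => [x|w ww]; first by rewrite lern1 leq_b1.
  apply: le_trans (no_new_n S nS); apply: ler_avg => x; rewrite ler_nat.
  case: (boolP (no_new (app w x))) => // /forallP wx.
  rewrite (_ : no_new x) //; apply/forallP => s; have [j wj] := ww s.
  by have := wx j; rewrite ffunE wj.
have avgD2c : 2 * c <= avg (fun q => dens R (D q.1 q.2)).
  have -> : 2 * c = al / 4 / #|{ffun T -> option X}|%:R by rewrite /c; field; rewrite gt_eqF.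
  apply: le_trans uc _; apply: ler_avg => -[a y]; apply: le_dens => x /= /forallP h.
  by apply/forallP => i; rewrite ED.
have avgBe : al - e <= avg (fun q => dens R (B q.1 q.2)).
  rewrite /dens avg_pair; apply: avg_ge_cst => [|a]; first exact: Y0.
  rewrite exchange_avg; apply: avg_ge_cst => [|x]; first exact: Y0.
  exact: (fibre (fill u t0 a x)).
(* By averaging, one pair (a, y) serves for both B and D: weighted by la, a loss
   of order e / c in the density of B offsets the whole density of D. *)
pose la : R := c / (3 * e).
have la0 : 0 < la by apply: divr_gt0 => //; apply: mulr_gt0.
have lae : la * (3 * e) = c by rewrite /la; field; rewrite gt_eqF.
have [[a y] /= ay] : exists q, c <= dens R (D q.1 q.2) +
    la * (dens R (B q.1 q.2) - (al + 2 * e)).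
  apply: avg_attained; first by rewrite card_prod muln_gt0 !Y0.
  rewrite avgD avgZ avgB avg_cst ?card_prod ?muln_gt0 ?Y0 //.
  have := ler_wpM2l (ltW la0) avgBe; move: avgD2c lae; clear; lra.
have D1 : dens R (D a y) <= 1 by apply: dens_le1.
have Dc : c <= dens R (D a y).
  apply: le_trans ay _; rewrite gerDl mulr_ge0_le0 ?(ltW la0) // subr_le0.
  exact: Bal.
have Bc : al - 3 * e / c <= dens R (B a y).
  have : - 1 <= la * (dens R (B a y) - (al + 2 * e)).
    by move: ay c0 D1; clear; lra.
  rewrite mulrC -ler_pdivrMr //.
  have -> : -1 / la = - (3 * e / c) by rewrite /la; field; rewrite !gt_eqF.
  by move: e0; clear; lra.
have le2 : 0 <= 2 * e by apply: mulr_ge0 => //; apply: ltW.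
have := avoid_intersection X0 le2 (sparse a y) (BD a y).
rewrite -/(D a y) -/K => final.
have alD := ler_wpM2l (ltW al_gt0) Dc.
have alc : 0 < al * c by rewrite mulr_gt0.
have e2 : 3 * e / c <= 3 * (al * c) / 16.
  by rewrite ler_pdivrMr //; move: eK eKe; clear; lra.
have e3 := ler_wpM2l (ltW alc) c1.
move: final alD alc e2 e3 eK eKe Bc; clear; lra.
Qed.

End Step.

Local Open Scope classical_set_scope.

(** * Patterns in large sets *)

Section Largeness.
Variable R : realType.

(** Iterating the passage from X to option X yields alphabets carrying any
    initial segment of the integers as letter values. *)
Lemma DHJ_valued (k : nat) : exists (X : finType) (v : X -> nat),
  [/\ (0 < #|X|)%N, DHJ R X & forall i, (i <= k)%N -> exists a, v a = i].
Proof.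
elim: k => [|k [X [v [X0 HX vk]]]].
  exists unit, (fun=> 0%N); split; first by rewrite card_unit.
    move=> d d0; exists unit => A dA.
    have [|x Ax] := @dens_attained R _ A; first exact: lt_le_trans dA.
    move=> /(_ [ffun => None]); apply; first by apply/existsP; exists tt; rewrite ffunE.
    by move=> a; rewrite (_ : inst _ a = x) //; apply/ffunP => -[]; case: (inst _ _ _); case: (x _).
  by case=> // _; exists tt.
exists (option X), (fun o => if o is Some a then v a else k.+1).
split; [exact: card_opt_gt0|exact: DHJ_option|] => i.
rewrite leq_eqVlt => /predU1P[->|]; first by exists None.
by rewrite ltnS => /vk[a <-]; exists (Some a).
Qed.

Lemma line_value (I X : finType) (v : X -> nat) (u : {ffun I -> option X}) :
  variable u -> exists c r, (0 < r)%N /\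
    forall a, (\sum_i v (inst u a i) = c + r * v a)%N.
Proof.
move=> /existsP[i0 ui0].
exists (\sum_(i | u i != None) if u i is Some a then v a else 0)%N.
exists #|[pred i | u i == None]|; split; first by apply/card_gt0P; exists i0.
move=> a; rewrite (bigID (fun i => u i != None)) /=; congr addn.
  by apply: eq_bigr => i; rewrite ffunE; case: (u i).
rewrite -sum_nat_const; apply: eq_big => [i|i]; first by rewrite negbK.
by rewrite negbK ffunE => /eqP->.
Qed.

Lemma limn_sup_gt0 (u : nat -> R) : (forall n, 0 <= u n <= 1) ->
  0 < limn_sup u -> exists2 d : R, 0 < d & forall N, exists2 n, (N <= n)%N & d <= u n.
Proof.
move=> u01.
have ub : has_ubound (range u) by exists 1 => _ [n _ <-]; have /andP[] := u01 n.
have lb : has_lbound (range u) by exists 0 => _ [n _ <-]; have /andP[] := u01 n.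
have -> : limn_sup u = inf (range (sups u)).
  by apply/cvg_lim => //; apply: cvg_sups_inf.
set L := inf _ => L0; exists (L / 2) => [|N]; first by rewrite divr_gt0.
have LN : L <= sups u N.
  apply: ge_inf; last by exists N.
  exists 0 => _ [n _ <-]; apply: (@le_trans _ _ (u n)); first by have /andP[] := u01 n.
  by apply: ub_le_sup; [exact: has_ubound_sdrop|exists n => /=].
have hs : has_sup (sdrop u N).
  by split; [exists (u N), N => /=|exact: has_ubound_sdrop].
have [|_ [n /= Nn <-] un] := @sup_adherent R _ (L / 2) _ hs; first by rewrite divr_gt0.
by exists n => //; rewrite /sups /= in LN; lra.
Qed.

Lemma limn_sup_ge (u : nat -> R) d : (forall n, 0 <= u n <= 1) ->
  (forall N, exists2 n, (N <= n)%N & d <= u n) -> d <= limn_sup u.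
Proof.
move=> u01 hd.
have ub : has_ubound (range u) by exists 1 => _ [n _ <-]; have /andP[] := u01 n.
have lb : has_lbound (range u) by exists 0 => _ [n _ <-]; have /andP[] := u01 n.
have -> : limn_sup u = inf (range (sups u)).
  by apply/cvg_lim => //; apply: cvg_sups_inf.
apply: lb_le_inf; first by exists (sups u 0%N), 0%N.
move=> _ [N _ <-]; have [n Nn dn] := hd N; apply: le_trans dn _.
by apply: ub_le_sup; [exact: has_ubound_sdrop|exists n => /=].
Qed.

Lemma card_fset_cond (f : {fset nat}) (P : pred nat) :
  #|` [fset h in f | P h]%fset| = (\sum_(h <- f) P h)%N.
Proof.
rewrite card_fset_sum1 -big_fset_condE /= big_mkcond.
by apply: eq_bigr => h _; case: (P h).
Qed.

Lemma ratio01 (f : {fset nat}) (P : pred nat) :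
  0 <= (#|` [fset h in f | P h]%fset|%:R / #|` f|%:R : R) <= 1.
Proof.
rewrite divr_ge0 ?ler0n //=; have [->|f0] := eqVneq f fset0.
  by rewrite cardfs0 invr0 mulr0.
rewrite ler_pdivrMr ?ltr0n ?cardfs_gt0 // mul1r ler_nat.
by apply/fsubset_leq_card/fsubsetP => h; rewrite !inE => /andP[].
Qed.

(** A point of f in S is the image of a point of f, or lies in the part of f not
    covered by its image, which is as large as the part moved out of f. *)
Lemma card_pullback (op : nat -> nat) (f : {fset nat}) (S : pred nat) :
  injective op ->
  (#|` [fset h in f | S h]%fset| + #|` [fset h in f | op h \in f]%fset| <=
   #|` f| + #|` [fset h in f | S (op h)]%fset|)%N.
Proof.
move=> opI; set B := [fset h in f | op h \in f]%fset.
have BE : #|` [fset op h | h in B]%fset| = #|` B| by rewrite card_imfset.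
have Bf : ([fset op h | h in B] `<=` f)%fset.
  by apply/fsubsetP => _ /imfsetP[h /= + ->]; rewrite !inE => /andP[].
have fE := cardfsID [fset op h | h in B]%fset f.
rewrite (fsetIidPr Bf) BE in fE.
have SE := cardfsID [fset op h | h in B]%fset [fset h in f | S h]%fset.
have le1 : (#|` [fset h in f | S h] `\` [fset op h | h in B]|%fset <=
    #|` f `\` [fset op h | h in B]|%fset)%N.
  apply/fsubset_leq_card/fsubsetP => h.
  by rewrite !in_fsetD !inE => /andP[-> /andP[->]].
have le2 : (#|` [fset h in f | S h] `&` [fset op h | h in B]|%fset <=
    #|` [fset h in f | S (op h)]|%fset)%N.
  have <- : #|` [fset op h | h in [fset h in f | S (op h)]]%fset| =
      #|` [fset h in f | S (op h)]%fset| by rewrite card_imfset.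
  apply/fsubset_leq_card/fsubsetP => z /fsetIP[zS /imfsetP[h /= hB zE]].
  move: zS; rewrite zE !inE => /andP[_ Sh]; apply/imfsetP; exists h => //=.
  by move: hB; rewrite !inE Sh andbT => /andP[].
by rewrite /B in fE SE le1 le2 *; lia.
Qed.

(** The theorem for a large set: the words x act by the elements e (sum of v x).
    By invariance, averaging over the Folner set gives a point h for which the
    words x moving h into S form a dense set, which contains a line. *)
Lemma large_pattern (op : nat -> nat -> nat) (S : set nat) (X : finType)
    (v : X -> nat) (e : nat -> nat) :
  (0 < #|X|)%N -> DHJ R X -> (forall s, posnat (e s)) ->
  (forall g, posnat g -> injective (op g)) -> large R op S ->
  exists h c r, [/\ posnat h, (0 < r)%N &
    forall a, S (op (e (c + r * v a)%N) h)].
Proof.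
move=> X0 HX e0 opI [F [[F0 Fpos Finv]]].
rewrite /upper_density => /limn_sup_gt0[n|d d0 hd].
  exact: (ratio01 (F n) (fun h => h \in S)).
have d20 : 0 < d / 2 by rewrite divr_gt0.
have [I HI] := HX _ d20.
pose g (x : {ffun I -> X}) := e (\sum_i v (x i))%N.
have /choice[N HN] (x : {ffun I -> X}) : exists N, forall n, (N <= n)%N ->
    1 - d / 2 <= #|` [fset h in F n | op (g x) h \in F n]%fset|%:R / #|` F n|%:R :> R.
  have /cvgrPdist_le/(_ _ d20)[N _ HN] := Finv (g x) (e0 _).
  by exists N => n Nn; have := HN n Nn; rewrite ler_norml /=; lra.
have [n Nn dn] := hd (\max_x N x)%N.
have f0 : (0 < #|{: F n}|)%N by rewrite -cardfE cardfs_gt0 F0.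
have f0' : 0 < #|` F n|%:R :> R by rewrite cardfE ltr0n.
have avgE (P : pred nat) : avg (fun h : F n => (P (val h))%:R : R) =
    #|` [fset h in F n | P h]%fset|%:R / #|` F n|%:R.
  rewrite /avg card_fset_cond natr_sum big_seq_fsetE cardfE; congr (_ / _).
have Wgt0 : (0 < #|{ffun I -> X}|)%N by apply: card_word_gt0.
have [h dh] : exists h : F n, d / 2 <= dens R (fun x => op (g x) (val h) \in S).
  apply: avg_attained => //; rewrite /dens exchange_avg.
  apply: avg_ge_cst => // x; rewrite (avgE (fun h => op (g x) h \in S)).
  have := HN x n (leq_trans (leq_bigmax x) Nn).
  have := @card_pullback (op (g x)) (F n) (fun h => h \in S) (opI _ (e0 _)).
  rewrite -(ler_nat R) !natrD !ler_pdivlMr // in dn *; lra.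
have /existsNP[u /not_implyP[vu /contrapT uS]] := HI _ dh.
have [c [r [r0 cr]]] := line_value v vu.
exists (val h), c, r; split=> // [|a]; first exact: (Fpos n _ (valP h)).
by have := uS a; rewrite /g cr inE.
Qed.

End Largeness.

(** * Additive largeness is finitary *)

Section Additive.

Definition cnt (E : pred nat) (s D : nat) : nat := (\sum_(m < D) E (s + m.+1))%N.

Lemma cnt_cat E s D1 D2 : cnt E s (D1 + D2) = (cnt E s D1 + cnt E (s + D1) D2)%N.
Proof.
rewrite /cnt big_split_ord /=; congr addn; apply: eq_bigr => m _.
by rewrite -addnS addnA.
Qed.

(** Some translate of a dense set is dense in all its initial segments: else
    the interval would be covered, up to a short end, by sparse pieces. *)
Lemma dense_shift (E : pred nat) n : (n.+1 <= 16 * cnt E 0 n.+1)%N ->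
  exists s, forall D, (D <= n)%N -> (D <= 32 * cnt E s D)%N.
Proof.
move=> dE; apply: contrapT => /forallNP NE.
have cover D : forall s, (32 * cnt E s D <= D + n)%N.
  elim/ltn_ind: D => D IH s.
  have /existsNP[M /not_implyP[Mn /negP]] := NE s; rewrite -ltnNge => EM.
  have [DM|MD] := leqP D M.
    by have := cnt_cat E s D (M - D); rewrite subnKC //; lia.
  have DMD : (D - M < D)%N by lia.
  have := IH _ DMD (s + M)%N; have := cnt_cat E s M (D - M).
  by rewrite (subnKC (ltnW MD)) => ->; lia.
by have := cover n.+1 0%N; lia.
Qed.

Variable R : realType.

Definition interval (n : nat) : {fset nat} := [fset x in iota 1 n.+1]%fset.

Lemma sum_interval n (P : pred nat) :
  (\sum_(h <- interval n) P h = \sum_(m < n.+1) P m.+1)%N.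
Proof.
rewrite (perm_big (iota 1 n.+1)).
  by rewrite -[iota 1 n.+1]/(index_iota 1 n.+2) big_add1 big_mkord.
apply: uniq_perm; rewrite ?fset_uniq ?iota_uniq // => x.
by rewrite in_fset /= .
Qed.

Lemma card_interval n : #|` interval n| = n.+1.
Proof.
by rewrite card_fset_sum1 (sum_interval n predT) sum_nat_const card_ord muln1.
Qed.

Lemma interval_folner : folner R addn interval.
Proof.
split=> [n|n x /=|g _].
- by rewrite -cardfs_gt0 card_interval.
- by rewrite in_fset mem_iota /= => /andP[].
apply/cvgrPdist_le => e e0.
near=> n.
rewrite card_interval card_fset_cond sum_interval.
have gn : (n.+1 - g <= \sum_(m < n.+1) (g + m.+1 \in interval n) <= n.+1)%N.
  apply/andP; split; last first.
    rewrite -[leqRHS]card_ord -sum1_card; apply: leq_sum => m _; exact: leq_b1.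
  have -> : (n.+1 - g = \sum_(m < n.+1 - g) 1)%N by rewrite sum_nat_const card_ord muln1.
  rewrite (big_ord_widen n.+1 (fun=> 1%N) (leq_subr g _)) big_mkcond.
  apply: leq_sum => m _; case: ifP => // mg.
  by rewrite in_fset mem_iota; lia.
have n0 : 0 < n.+1%:R :> R by rewrite ltr0n.
case/andP: gn; set k := (\sum_(m < n.+1) _)%N => g1 g2.
have -> : 1 - k%:R / n.+1%:R = (n.+1 - k)%:R / n.+1%:R :> R.
  by rewrite natrB // mulrBl divff // gt_eqF.
rewrite ger0_norm ?divr_ge0 ?ler0n // ler_pdivrMr //.
apply: (@le_trans _ _ g%:R); first by rewrite ler_nat; lia.
rewrite -ler_pdivrMl // mulrC.
apply: (@le_trans _ _ n%:R); last by rewrite ler_nat.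
by near: n; apply: nbhs_infty_ger.
Unshelve. all: by end_near. Qed.

(** Compactness: a property of all additively large sets is already forced on
    dense subsets of one finite interval. The limit along an ultrafilter of
    suitably shifted counterexamples is additively large. *)
Lemma additively_large_finitary (Sa : set {fset nat}) :
  (forall S : set nat, S `<=` posnat -> additively_large R S ->
     exists F1 a, [/\ Sa F1, posnat a & translate a F1 `<=` S]) ->
  exists2 N, (0 < N)%N & forall E : pred nat, (N <= 16 * cnt E 0 N)%N ->
    exists F1 a, [/\ Sa F1, posnat a &
      forall f, f \in F1 -> E (a + f)%N && (a + f <= N)%N].
Proof.
move=> HSa; apply: contrapT => NN.
have /choice[E HE] n : exists E : pred nat, (n.+1 <= 16 * cnt E 0 n.+1)%N /\
    ~ exists F1 a, [/\ Sa F1, posnat a &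
      forall f, f \in F1 -> E (a + f)%N && (a + f <= n.+1)%N].
  apply: contrapT => /forallNP H; apply: NN; exists n.+1 => // E dE.
  by apply: contrapT => H'; apply: (H E).
pose E' n : pred nat := fun m => E n m && (m <= n.+1)%N.
have /choice[s Hs] n : exists s, forall D, (D <= n)%N ->
    (D <= 32 * cnt (E' n) s D)%N.
  apply: dense_shift; have [dE _] := HE n; apply: leq_trans dE _.
  rewrite leq_mul2l /=; apply: leq_sum => m _; rewrite /E' add0n.
  by rewrite ltn_ord andbT.
have [U [UU leU]] := @ultraFilterLemma _ (\oo : set_system nat) _.
have UP : ProperFilter U by apply: ultra_proper.
pose X : set nat := [set m | (0 < m)%N /\ U [set n | E' n (s n + m)%N]].
have agree D : U [set n | forall m, (m < D)%N ->
    E' n (s n + m.+1)%N = (m.+1 \in X)].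
  elim: D => [|D IH]; first by apply: filterS filterT => n _ m.
  have HD : U [set n | E' n (s n + D.+1)%N = (D.+1 \in X)].
    have [XD|XD] := boolP (D.+1 \in X).
      by move: XD; rewrite inE => -[_]; apply: filterS => n /= ->.
    have [UD|] := in_ultra_setVsetC [set n | E' n (s n + D.+1)%N] UU.
      by case/negP: XD; rewrite inE.
    by apply: filterS => n /= /negP/negbTE ->.
  apply: filterS2 IH HD => n /= h1 h2 m; rewrite ltnS leq_eqVlt.
  by move=> /predU1P[->|/h1].
have dX D : (D <= 32 * \sum_(m < D) (m.+1 \in X))%N.
  have UD : U [set n | (D <= n)%N] by apply: leU; exists D.
  have [n /= [h1 h2]] := filter_ex (filterI (agree D) UD).
  have -> : (\sum_(m < D) (m.+1 \in X) = cnt (E' n) (s n) D)%N.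
    by apply: eq_bigr => m _; rewrite h1.
  exact: Hs.
have [||F1 [a [SF1 a0 aX]]] := HSa X.
- by move=> m [].
- exists interval; split; first exact: interval_folner.
  apply: (@lt_le_trans _ _ (32^-1)); first by rewrite invr_gt0.
  apply: limn_sup_ge => [n|N]; first exact: (ratio01 R (interval n) (fun h => h \in X)).
  exists N => //; rewrite (card_fset_cond _ (fun h => h \in X)).
  rewrite (sum_interval N (fun h => h \in X)) card_interval.
  rewrite ler_pdivlMr ?ltr0n // mulrC ler_pdivrMr // mulrC -natrM ler_nat.
  exact: dX.
pose D := (\max_(f <- F1) (a + f)).+1%N.
have [n /= hn] := filter_ex (agree D).
have [_] := HE n; apply; exists F1, (s n + a)%N; split=> // [|f fF].
  by rewrite /posnat /= addn_gt0 [(0 < a)%N]a0 orbT.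
have afX : (a + f)%N \in X by rewrite inE; apply: aX; exists f.
have [af0 _] : X (a + f)%N by rewrite inE in afX.
have afD : ((a + f).-1 < D)%N.
  rewrite prednK // ltnW // ltnS; exact: leq_bigmax_seq.
have := hn _ afD; rewrite prednK // afX addnA => /andP[h1 h2].
by rewrite h1 h2.
Qed.

End Additive.

(** * Multiples in normal sets *)

Section Normal.
Variable R : realType.

Lemma prod_residue (j r m : nat) (a : R) : (r < j)%N ->
  \prod_(p < m * j) (if (p %% j == r)%N then a else 1) = a ^+ m.
Proof.
move=> rj; elim: m => [|m IH]; first by rewrite mul0n big_ord0.
rewrite mulSn big_split_ord /= exprS; congr (_ * _).
  rewrite (bigD1 (Ordinal rj)) //= modn_small // eqxx big1 ?mulr1 // => p pr.
  rewrite modn_small //; case: eqP => // e.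
  by case/negP: pr; apply/eqP/val_inj.
by rewrite -IH; apply: eq_bigr => p _; rewrite modnDl.
Qed.

Definition balanced (j l k : nat) (w : 'I_k -> bool) : bool :=
  [forall r : 'I_j, l <= \sum_(p < k) ((p %% j == r) && w p)]%N.

(** Long words are mostly balanced: each class of 4 l positions has fewer than
    l ones with exponentially small probability, by Markov's inequality for
    2 to the power minus the number of ones. *)
Lemma mostly_balanced (j : nat) : (0 < j)%N -> exists2 l, (0 < l)%N &
  3 / 4 <= dens R (fun w : {ffun 'I_(4 * l * j) -> bool} => balanced j l w).
Proof.
move=> j0; have j0' : 0 < j%:R :> R by rewrite ltr0n.
(* 81 / 128 is 2 (3 / 4)^4, the l-th root of the bound for one class *)
have q01 : 0 <= (81 / 128 : R) < 1 by lra.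
have c0 : 0 < (4 * j%:R)^-1 :> R by rewrite invr_gt0; lra.
have [l0 hl0] := small_power q01 c0.
pose l := l0.+1.
have hl : (81 / 128) ^+ l <= (4 * j%:R)^-1 :> R.
  apply: le_trans hl0; rewrite /l exprS -[leRHS]mul1r ler_wpM2r ?exprn_ge0 //; lra.
exists l => //; set k := (4 * l * j)%N.
have W0 : (0 < #|{ffun 'I_k -> bool}|)%N by rewrite card_word_gt0 // card_bool.
have class (r : 'I_j) : avg (fun w : {ffun 'I_k -> bool} =>
    (\sum_(p < k) ((p %% j == r) && w p) < l)%N%:R) <= (4 * j%:R)^-1 :> R.
  pose F (p : 'I_k) (b : bool) : R := if (p %% j == r)%N && b then 2^-1 else 1.
  apply: le_trans hl; apply: (@le_trans _ _ (avg (fun w : {ffun 'I_k -> bool} =>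
    2 ^+ l * \prod_p F p (w p)))).
    apply: ler_avg => w.
    have -> : \prod_p F p (w p) = 2^-1 ^+ (\sum_(p < k) ((p %% j == r) && w p))%N.
      rewrite expr_sum; apply: eq_bigr => p _; rewrite /F.
      by case: (_ && _); rewrite ?expr1 ?expr0.
    case: ltnP => [lt|_]; last by rewrite mulr_ge0 ?exprn_ge0 ?invr_ge0.
    by rewrite exprVn -expfB // exprn_ege1 // ler1n.
  rewrite avgZ (@avg_prod _ _ _ F).
  rewrite (eq_bigr (fun p : 'I_k => if (p %% j == r)%N then 3 / 4 else 1)).
    rewrite prod_residue // exprM -exprMn; apply: lerXn2r; rewrite ?nnegrE; lra.
  move=> p _; rewrite /avg /F card_bool big_bool andbT andbF.
  by case: ifP => _ /=; lra.
have -> : dens R (fun w : {ffun 'I_k -> bool} => balanced j l w) =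
    1 - dens R (fun w : {ffun 'I_k -> bool} => ~~ balanced j l w).
  rewrite -(avg_cst (T := {ffun 'I_k -> bool}) 1 W0) /dens -avgB.
  by apply: eq_avg => w; case: balanced; rewrite ?subr0 ?subrr.
suff : dens R (fun w : {ffun 'I_k -> bool} => ~~ balanced j l w) <= 1 / 4 by lra.
apply: (@le_trans _ _ (\sum_(r < j) avg (fun w : {ffun 'I_k -> bool} =>
    (\sum_(p < k) ((p %% j == r) && w p) < l)%N%:R))).
  rewrite -avg_sum; apply: ler_avg => w; case: (boolP (balanced j l w)) => /=.
    by move=> _; apply: sumr_ge0.
  rewrite negb_forall => /existsP[r]; rewrite -ltnNge => lr.
  by rewrite (bigD1 r) //= lr lerDl sumr_ge0.
apply: (@le_trans _ _ (\sum_(r < j) (4 * j%:R)^-1)); first exact: ler_sum.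
suff -> : \sum_(r < j) (4 * j%:R)^-1 = 1 / 4 :> R by [].
by rewrite sumr_const card_ord -[LHS]mulr_natl; field; rewrite gt_eqF.
Qed.

Lemma sum_multiples (j C : nat) (x : nat -> bool) : (0 < j)%N ->
  (\sum_(p < j * C) ((j %| p.+1) && x p.+1) = \sum_(c < C) x (j * c.+1))%N.
Proof.
move=> j0; elim: C => [|C IH]; first by rewrite muln0 !big_ord0.
rewrite mulnSr big_split_ord big_ord_recr /= IH; congr addn.
case: j j0 {IH} => // j _; rewrite big_ord_recr /= -addnS -mulnSr dvdn_mulr //=.
rewrite big1 // => p _; rewrite -addnS dvdn_addr ?dvdn_mulr //.
by rewrite gtnNdvd // ltnS ltn_ord.
Qed.

(** A balanced window contains at least l elements divisible by j wherever it
    starts, and each element belongs to at most k windows. *)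
Lemma word_count_bound (x : nat -> bool) (j l k n : nat) : (0 < j)%N -> (k <= n.+1)%N ->
  (l * \sum_(w : k.-tuple bool | balanced j l (tnth w)) word_count x w n <=
   k * \sum_(p < n) ((j %| p.+1) && x p.+1))%N.
Proof.
move=> j0 kn; pose F p : nat := (j %| p)%N && x p.
pose W m : k.-tuple bool := [tuple x (m + i)%N | i < k].
have WE m : [seq x i | i <- iota m k] = W m.
  rewrite /W /= -[m in LHS]addn0 iotaDl -map_comp -val_enum_ord -map_comp.
  by rewrite enumT.
have ones m : (l * \sum_(w : k.-tuple bool | balanced j l (tnth w)) (W m == w) <=
    \sum_(i < k) F (m + i))%N.
  have [bW|bW] := boolP (balanced j l (tnth (W m))); last first.
    rewrite big1 ?muln0 // => w bw; case: eqP => // e; by rewrite e bw in bW.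
  rewrite (bigD1 (W m)) //= eqxx big1 ?addn0 ?muln1; last first.
    by move=> w /andP[_]; rewrite eq_sym => /negbTE->.
  pose r : 'I_j := Ordinal (ltn_pmod (j - m %% j) j0).
  move/forallP: bW => /(_ r)/leq_trans; apply; apply: leq_sum => i _.
  rewrite /F tnth_mktuple; case: (x (m + i)%N); rewrite ?andbF //= !andbT.
  case: eqP => //= e; suff -> : (j %| m + i)%N by [].
  rewrite /dvdn -modnDmr e modnDmr -modnDml subnKC ?modnn //.
  by rewrite ltnW // ltn_pmod.
have -> : (\sum_(w : k.-tuple bool | balanced j l (tnth w)) word_count x w n =
    \sum_(m <- iota 1 (n.+1 - k))
      \sum_(w : k.-tuple bool | balanced j l (tnth w)) (W m == w))%N.
  rewrite exchange_big /=; apply: eq_bigr => w _.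
  rewrite /word_count size_tuple -sum1_count big_mkcond /=.
  apply: eq_bigr => m _; rewrite WE -val_eqE /=.
  by case: eqP.
rewrite big_distrr /=; apply: (@leq_trans (\sum_(m <- iota 1 (n.+1 - k))
  \sum_(i < k) F (m + i))%N); first exact: leq_sum.
rewrite exchange_big /= -[k in leqRHS]card_ord -sum_nat_const.
apply: leq_sum => i _.
set q := (n.+1 - k)%N; have ik := ltn_ord i.
have qin : (i + q <= n)%N by rewrite /q; lia.
have -> : (\sum_(m <- iota 1 q) F (m + i) = \sum_(i <= p < i + q) F p.+1)%N.
  have -> : (\sum_(i <= p < i + q) F p.+1 = \sum_(0 <= p < q) F (p + i).+1)%N.
    by rewrite -{1}(add0n i) big_addn addKn.
  rewrite big_mkord.
  have -> : iota 1 q = index_iota 1 q.+1 by rewrite /index_iota subn1.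
  by rewrite big_add1 big_mkord; apply: eq_bigr => m _; rewrite addSn.
rewrite -(big_mkord xpredT (fun p => F p.+1)).
rewrite (@big_cat_nat _ _ _ (i + q)%N 0 n) //= (@big_cat_nat _ _ _ i 0 (i + q)%N) ?leq_addr //=.
by rewrite -addnA addnCA leq_addr.
Qed.

Lemma cvg_finite_sum (I : finType) (P : pred I) (f : I -> nat -> R) (l : I -> R) :
  (forall i, f i n @[n --> \oo] --> l i) ->
  (\sum_(i | P i) f i n) @[n --> \oo] --> \sum_(i | P i) l i.
Proof.
move=> fl; elim: (index_enum I) => [|i r IH].
  by rewrite big_nil; under eq_cvg do rewrite big_nil; exact: cvg_cst.
rewrite big_cons; under eq_cvg do rewrite big_cons.
by case: (P i) => //; apply: cvgD.
Qed.

(** Since most words are balanced, so are most windows of a normal sequence. The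
    proportion 1 / 8 does not depend on j, so that averages over many multiples
    can be taken. *)
Lemma normal_multiples (x : nat -> bool) (j : nat) : normal_sequence R x ->
  (0 < j)%N -> exists C0, forall C, (C0 <= C)%N ->
    (C <= 8 * \sum_(c < C) x (j * c.+1))%N.
Proof.
move=> xN j0; have [l l0 hl] := mostly_balanced j0.
set k := (4 * l * j)%N in hl.
have k0 : (0 < k)%N by rewrite !muln_gt0 l0 j0.
pose G n := (\sum_(w : k.-tuple bool | balanced j l (tnth w)) word_count x w n)%N.
have cvG : (G n)%:R / n%:R @[n --> \oo] -->
    (\sum_(w : k.-tuple bool | balanced j l (tnth w)) 2^-1 ^+ k : R).
  rewrite [X in X @ _](_ : _ = fun n =>
    \sum_(w : k.-tuple bool | balanced j l (tnth w)) (word_count x w n)%:R / n%:R).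
    by apply: cvg_finite_sum => w; exact: xN.
  by apply/funext => n; rewrite /G natr_sum mulr_suml.
have sumE : \sum_(w : k.-tuple bool | balanced j l (tnth w)) 2^-1 ^+ k =
    dens R (fun w : {ffun 'I_k -> bool} => balanced j l w).
  rewrite /dens /avg card_ffun card_bool card_ord mulr_suml natrX.
  rewrite (reindex (@tuple_of_finfun _ _)) /=; last first.
    by exists (@finfun_of_tuple _ _) => f _; rewrite ?tuple_of_finfunK ?finfun_of_tupleK.
  rewrite big_mkcond; apply: eq_bigr => w _; rewrite exprVn.
  rewrite (_ : balanced j l (tnth _) = balanced j l w).
    by case: balanced; rewrite ?mul1r ?mul0r.
  apply: eq_forallb => r; congr (_ <= _)%N; apply: eq_bigr => p _.
  by rewrite tnth_mktuple.
rewrite sumE in cvG.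
have /cvgrPdist_le/(_ (1 / 4) _)[|N0 _ HN] := cvG; first by lra.
exists (N0 + k)%N => C CN.
have jC : (C <= j * C)%N by rewrite leq_pmull.
have kC : (k <= (j * C).+1)%N by lia.
have Cgt0 : (0 < j * C)%N by lia.
have := HN (j * C)%N _; rewrite /= => /(_ ltac:(lia)).
rewrite ler_norml => /andP[_ GC].
have {}GC : (j * C <= 2 * G (j * C))%N.
  have : 1 / 2 <= (G (j * C)%N)%:R / (j * C)%:R :> R by lra.
  rewrite ler_pdivlMr ?ltr0n // => GC'.
  by rewrite -(ler_nat R) natrM; lra.
have := @word_count_bound x j l k (j * C) j0 kC; rewrite -/(G _) sum_multiples //.
rewrite /k => h.
have h2 : (l * (j * C) <= 2 * (l * G (j * C)))%N.
  by rewrite [leqRHS]mulnCA leq_mul2l GC orbT.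
rewrite -(leq_pmul2l l0) -(leq_pmul2l j0); move: h h2.
set S := (\sum_(c < C) _)%N; set g := (l * _)%N => h h2.
have -> : (j * (l * C) = l * (j * C))%N by rewrite mulnCA.
by apply: leq_trans h2 _; apply: leq_trans (leq_mul (leqnn 2) h) _; lia.
Qed.

(** By averaging over c; a common c exists as only finitely many b m occur. *)
Lemma normal_dilate (x : nat -> bool) (N : nat) (K : seq nat) :
  normal_sequence R x -> (forall b, b \in K -> (0 < b)%N) ->
  exists2 c, (0 < c)%N &
    (size K * N <= 8 * \sum_(b <- K) \sum_(m < N) x (c * b * m.+1))%N.
Proof.
move=> xN K0.
have /choice[C0 HC] (p : nat * nat) : exists C0, (0 < p.1)%N -> (0 < p.2)%N ->
    forall C, (C0 <= C)%N -> (C <= 8 * \sum_(c < C) x (p.1 * p.2 * c.+1))%N.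
  have [->|p1] := posnP p.1; first by exists 0%N.
  have [->|p2] := posnP p.2; first by exists 0%N.
  have [C0 h] := normal_multiples xN (ltac:(by rewrite muln_gt0 p1 p2) : (0 < p.1 * p.2)%N).
  by exists C0.
pose C := (\max_(b <- K) \max_(m < N) C0 (b, m.+1)).+1.
have bound b m : b \in K -> (m < N)%N ->
    (C <= 8 * \sum_(c < C) x (b * m.+1 * c.+1))%N.
  move=> bK mN; apply: (HC (b, m.+1)) => //=; first exact: K0.
  rewrite /C ltnW // ltnS.
  apply: (@leq_trans (\max_(m < N) C0 (b, m.+1))).
    exact: (leq_bigmax (Ordinal mN)).
  exact: leq_bigmax_seq.
have total : (C * (size K * N) <=
    \sum_(c < C) (8 * \sum_(b <- K) \sum_(m < N) x (c.+1 * b * m.+1)))%N.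
  rewrite -big_distrr /= exchange_big /= big_distrr /=.
  rewrite mulnCA -sum1_size big_distrl /= !big_seq; apply: leq_sum => b bK.
  rewrite exchange_big /= big_distrr /= mul1n -[N in (C * N)%N]card_ord.
  rewrite mulnC -sum_nat_const; apply: leq_sum => m _.
  apply: leq_trans (bound b m bK (ltn_ord m)) _; rewrite leq_mul2l /=.
  by apply: leq_sum => c _; rewrite mulnC mulnA.
apply: contrapT => H; suff : (C * (size K * N) < C * (size K * N))%N by rewrite ltnn.
apply: leq_ltn_trans total _.
rewrite -[C in ltnRHS]card_ord -sum_nat_const.
have strict (c : 'I_C) : (8 * \sum_(b <- K) \sum_(m < N) x (c.+1 * b * m.+1) <
    size K * N)%N.
  by rewrite ltnNge; apply/negP => h; apply: H; exists c.+1.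
rewrite (bigD1 ord0) //= [ltnRHS](bigD1 ord0) //= -addSn; apply: leq_add.
  exact: (strict ord0).
by apply: leq_sum => c _; apply: ltnW (strict c).
Qed.

End Normal.

(** * Popular sections of a normal set *)

Section Multiplicative.

(** Every prime power p^n with p at most n divides [box n], so that the divisors of
    [box n] form a Folner sequence for multiplication. *)
Definition box (n : nat) : nat := (n`! ^ n)%N.

Definition divs (n : nat) : {fset nat} := [fset d in divisors (box n)]%fset.

Lemma box_gt0 n : (0 < box n)%N.
Proof. by rewrite expn_gt0 fact_gt0. Qed.

Lemma in_divs n d : (d \in divs n) = (d %| box n)%N.
Proof. by rewrite in_fset /= dvdn_divisors ?box_gt0. Qed.

Definition lost (g n : nat) : {fset nat} :=
  [fset h in divs n | (g * h)%N \notin divs n]%fset.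

(** If h divides [box n] and p h does not, then p^n divides h, and h yields the n + 1
    divisors h / p^j; these are distinct for distinct pairs (h, j). *)
Lemma lost_prime p n : prime p -> (p <= n)%N ->
  (n.+1 * #|` lost p n| <= #|` divs n|)%N.
Proof.
move=> pp pn; have p0 := prime_gt0 pp.
have lostP h : h \in lost p n ->
    [/\ (h %| box n)%N, (0 < h)%N, (p ^ n %| h)%N & ~~ (p * h %| box n)%N].
  rewrite !inE /= -!dvdn_divisors ?box_gt0 // => /andP[hM phM].
  have h0 : (0 < h)%N by apply: dvdn_gt0 hM; exact: box_gt0.
  split=> //; have /dvdnP[q qE] := hM.
  have pq : coprime (p ^ n) q.
    rewrite coprimeXl // prime_coprime //; apply: contra phM => pq.
    by rewrite qE dvdn_mul.
  by rewrite -(Gauss_dvdr _ pq) -qE /box dvdn_exp2r // dvdn_fact // p0 pn.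
pose J := iota 0 n.+1.
have mem_J j : (j \in J) = (j <= n)%N by rewrite mem_iota.
pose s := [seq (h %/ p ^ j)%N | h <- lost p n, j <- J].
have sz : size s = (n.+1 * #|` lost p n|)%N.
  by rewrite size_allpairs size_iota mulnC.
rewrite -sz; apply: uniq_leq_size; last first.
  move=> _ /allpairsP[[h j] /= [/lostP[hM h0 ph _] + ->]].
  rewrite mem_J => jn; rewrite in_divs.
  apply: dvdn_trans hM; apply: dvdn_div; exact: dvdn_trans (dvdn_exp2l p jn) ph.
apply: allpairs_uniq; rewrite ?fset_uniq ?iota_uniq //.
have key h j h' j' : h \in lost p n -> h' \in lost p n -> (j <= n)%N -> (j' <= n)%N ->
    (h %/ p ^ j = h' %/ p ^ j')%N -> (j <= j')%N -> j = j'.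
  move=> /lostP[_ _ ph nph] /lostP[h'M _ ph' _] jn j'n e.
  rewrite leq_eqVlt => /predU1P[//|jj']; case/negP: nph.
  apply: dvdn_trans h'M.
  rewrite -(divnK (dvdn_trans (dvdn_exp2l p jn) ph)).
  rewrite -(divnK (dvdn_trans (dvdn_exp2l p j'n) ph')) -e mulnCA dvdn_mul //.
  by rewrite -expnS dvdn_exp2l.
move=> x y /allpairsP[[h j] [hl + ->]]; rewrite mem_J => jn.
move=> /allpairsP[[h' j'] [hl' + ->]]; rewrite mem_J => jn' /= e.
rewrite /= in hl hl' jn jn'.
have jE : j = j'.
  have [jj|/ltnW jj] := leqP j j'; first exact: key e jj.
  by symmetry; apply: key (esym e) jj.
subst j'; congr (_, _).
have /lostP[_ _ ph _] := hl; have /lostP[_ _ ph' _] := hl'.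
rewrite -(divnK (dvdn_trans (dvdn_exp2l p jn) ph)) e.
by rewrite (divnK (dvdn_trans (dvdn_exp2l p jn) ph')).
Qed.

Lemma lost_mul g1 g2 n : (0 < g1)%N ->
  (#|` lost (g1 * g2) n| <= #|` lost g1 n| + #|` lost g2 n|)%N.
Proof.
move=> g10; pose B := [fset h in divs n |
  ((g1 * h)%N \in divs n) && ((g2 * (g1 * h))%N \notin divs n)]%fset.
have BE : #|` [fset (g1 * h)%N | h in B]%fset| = #|` B|.
  rewrite card_imfset //= => x y /eqP; rewrite eqn_pmul2l //; by move/eqP.
have Bl : (#|` B| <= #|` lost g2 n|)%N.
  rewrite -BE; apply/fsubset_leq_card/fsubsetP => z /imfsetP[h /= + zE].
  by rewrite !inE zE => /andP[_].
apply: leq_trans (leq_add (leqnn _) Bl).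
apply: (@leq_trans #|` (lost g1 n `|` B)%fset|); last by rewrite cardfsU leq_subr.
apply/fsubset_leq_card/fsubsetP => h; rewrite !inE => /andP[-> hl] /=.
by rewrite mulnA [(g2 * g1)%N]mulnC hl andbT orNb.
Qed.

Variable R : realType.

Lemma lost_negligible g (e : R) : (0 < g)%N -> 0 < e ->
  exists n0, forall n, (n0 <= n)%N -> #|` lost g n|%:R <= e * #|` divs n|%:R.
Proof.
elim/ltn_ind: g e => g IH e g0 e0.
have [g1|g1] := leqP g 1.
  exists 0%N => n _; have -> : lost g n = fset0.
    have -> : g = 1%N by lia.
    apply/fsetP => h; rewrite !inE mul1n; exact: andbN.
  by rewrite cardfs0 mulr_ge0 ?ler0n // ltW.
have e20 : 0 < e / 2 by rewrite divr_gt0.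
have pp := pdiv_prime g1; set p := pdiv g in pp.
have gE : g = (p * (g %/ p))%N by rewrite mulnC divnK // pdiv_dvd.
have gp0 : (0 < g %/ p)%N by rewrite divn_gt0 ?prime_gt0 // dvdn_leq ?pdiv_dvd.
have gp : (g %/ p < g)%N by rewrite ltn_Pdiv ?prime_gt1.
have [n1 H1] := IH _ gp _ gp0 e20.
exists (n1 + p + Num.bound (e / 2)^-1)%N => n hn.
have hb : (e / 2)^-1 <= n.+1%:R.
  apply: ltW; apply: lt_le_trans (archi_boundP _) _; first by rewrite invr_ge0 ltW.
  by rewrite ler_nat; lia.
have h2 : #|` lost p n|%:R <= e / 2 * #|` divs n|%:R.
  have := @lost_prime p n pp ltac:(lia); rewrite -(ler_nat R) natrM => h.
  rewrite -ler_pdivrMl //; apply: le_trans h.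
  by rewrite ler_wpM2r ?ler0n.
have := @lost_mul p (g %/ p) n (prime_gt0 pp); rewrite -gE -(ler_nat R) natrD.
have := H1 n ltac:(lia); lra.
Qed.

Definition dilated (c : nat -> nat) (n : nat) : {fset nat} :=
  [fset (c n * h)%N | h in divs n]%fset.

Lemma card_divs_gt0 n : (0 < #|` divs n|)%N.
Proof. by rewrite cardfs_gt0; apply/fset0Pn; exists 1%N; rewrite in_divs dvd1n. Qed.

Lemma sum_dilated c n (P : nat -> nat) : (0 < c n)%N ->
  (\sum_(y <- dilated c n) P y = \sum_(h <- divs n) P (c n * h))%N.
Proof.
move=> c0; rewrite /dilated big_imfset //= => x y _ _ /eqP.
by rewrite eqn_pmul2l // => /eqP.
Qed.

Lemma card_dilated c n : (0 < c n)%N -> #|` dilated c n| = #|` divs n|.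
Proof. by move=> c0; rewrite !card_fset_sum1 (sum_dilated (fun=> 1%N)). Qed.

Lemma dilated_folner (c : nat -> nat) : (forall n, 0 < c n)%N ->
  folner R muln (dilated c).
Proof.
move=> c0; split=> [n|n y /=|g g0].
- by rewrite -cardfs_gt0 card_dilated ?card_divs_gt0.
- move=> /imfsetP[h /=]; rewrite in_divs => hM ->.
  by rewrite /posnat /= muln_gt0 c0 (dvdn_gt0 _ hM) ?box_gt0.
apply/cvgrPdist_le => e e0; have [n0 H] := lost_negligible g0 e0.
exists n0 => // n /= nn0.
rewrite card_fset_cond (sum_dilated (fun y => (g * y)%N \in dilated c n)) // card_dilated //.
have -> : (\sum_(h <- divs n) ((g * (c n * h))%N \in dilated c n) =
    #|` divs n| - #|` lost g n|)%N.
  rewrite /lost card_fset_cond card_fset_sum1.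
  rewrite (eq_bigr (fun h => (g * h)%N \in divs n : nat)) => [|h _]; last first.
    congr (nat_of_bool _); rewrite mulnCA; apply/imfsetP/idP => [[h' /= h'd /eqP]|gh].
      by rewrite eqn_pmul2l // => /eqP->.
    by exists (g * h)%N.
  have <- : (\sum_(h <- divs n) ((g * h)%N \in divs n) +
      \sum_(h <- divs n) ((g * h)%N \notin divs n) = \sum_(h <- divs n) 1)%N.
    by rewrite -big_split /=; apply: eq_bigr => h _; case: (_ \in _).
  by rewrite addnK.
have ld : (#|` lost g n| <= #|` divs n|)%N.
  by apply/fsubset_leq_card/fsubsetP => h; rewrite !inE => /andP[].
have d0 : 0 < #|` divs n|%:R :> R by rewrite ltr0n card_divs_gt0.
rewrite natrB // mulrBl divff ?gt_eqF // opprB addrC subrK.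
by rewrite ger0_norm ?divr_ge0 ?ler0n // ler_pdivrMr // H.
Qed.


Lemma infinitely_often (T : finType) (f : nat -> T) :
  exists t, forall N, exists2 n, (N <= n)%N & f n = t.
Proof.
apply: contrapT => /forallNP H.
have /choice[N HN] t : exists N, forall n, (N <= n)%N -> f n <> t.
  have /existsNP[N HN] := H t; exists N => n Nn fn; apply: HN; by exists n.
by apply: (HN (f (\max_t N t)%N) (\max_t N t)%N) => //; apply: leq_bigmax.
Qed.

Definition section_word (x : nat -> bool) (N y : nat) : {ffun 'I_N -> bool} :=
  [ffun m : 'I_N => x (y * m.+1)%N].

(** For a suitable dilate of each Folner set, the section words of its elements
    contain at least N / 8 ones on average, so a positive proportion of them
    contain N / 16 ones. There are finitely many words of length N, so one of them
    is the section word of a multiplicatively large set of elements y. *)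
Lemma popular_section (x : nat -> bool) (N : nat) : (0 < N)%N ->
  normal_sequence R x ->
  exists2 s : {ffun 'I_N -> bool}, (N <= 16 * \sum_m s m)%N &
    large R muln [set y | posnat y /\ section_word x N y = s].
Proof.
move=> N0 xN.
have /choice[c Hc] n : exists c, (0 < c)%N /\
    (#|` divs n| * N <= 8 * \sum_(b <- divs n) \sum_(m < N) x (c * b * m.+1))%N.
  have [|c c0 h] := @normal_dilate R x N (divs n) xN; last by exists c.
  by move=> b; rewrite in_divs => /dvdn_gt0; apply; exact: box_gt0.
have c0 n : (0 < c n)%N by have [] := Hc n.
pose P : nat := #|{ffun 'I_N -> bool}|.
pose good (s : {ffun 'I_N -> bool}) := (N <= 16 * \sum_m s m)%N.
(* otherwise each word is rare, although most elements have a good word *)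
have /choice[f Hf] n : exists s, good s /\ (#|` divs n| <=
    16 * P * \sum_(b <- divs n) (section_word x N (c n * b) == s))%N.
  have [_ hc] := Hc n; apply: contrapT => /forallNP NH.
  have few s : good s -> (16 * P * \sum_(b <- divs n)
      (section_word x N (c n * b) == s) < #|` divs n|)%N.
    by move=> gs; rewrite ltnNge; apply/negP => h; apply: (NH s).
  have many : (#|` divs n| <=
      16 * \sum_(b <- divs n) good (section_word x N (c n * b)))%N.
    rewrite -(leq_pmul2r N0) -(leq_add2r (#|` divs n| * N)).
    have : (16 * \sum_(b <- divs n) \sum_(m < N) x (c n * b * m.+1) <=
      16 * N * \sum_(b <- divs n) good (section_word x N (c n * b)) + #|` divs n| * N)%N.
      rewrite card_fset_sum1 big_distrl /= !big_distrr -big_split /=.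
      apply: leq_sum => b _; rewrite mul1n /good.
      have -> : (\sum_(m < N) section_word x N (c n * b) m =
          \sum_(m < N) x (c n * b * m.+1))%N.
        by apply: eq_bigr => m _; rewrite ffunE.
      set t := (\sum_(m < N) _)%N.
      have tN : (t <= N)%N.
        by rewrite -[leqRHS]card_ord -sum1_card; apply: leq_sum => m _; exact: leq_b1.
      by case: leqP => /=; nia.
    by move: hc; nia.
  have : (16 * P * \sum_(b <- divs n) good (section_word x N (c n * b)) <=
      \sum_(s | good s) (16 * P * \sum_(b <- divs n) (section_word x N (c n * b) == s)))%N.
    rewrite -big_distrr /= leq_mul2l exchange_big /=; apply/orP; right.
    apply: leq_sum => b _; case: (boolP (good _)) => // gb.
    by rewrite (bigD1 (section_word x N (c n * b))) //= eqxx.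
  have : (\sum_(s | good s) (16 * P * \sum_(b <- divs n)
      (section_word x N (c n * b) == s)) < P * #|` divs n|)%N.
    apply: (@leq_ltn_trans (\sum_(s : {ffun 'I_N -> bool}) #|` divs n|.-1)).
      rewrite big_mkcond; apply: leq_sum => s _; case: ifP => // /few.
      by case: #|` divs n|.
    rewrite sum_nat_const ltn_pmul2l; first by rewrite prednK ?card_divs_gt0.
    by rewrite card_word_gt0 // card_bool.
  by move: many; nia.
have [s Hs] := infinitely_often f; exists s.
  by have [n _ <-] := Hs 0%N; have [] := Hf n.
set S := [set y | _]; exists (dilated c); split; first exact: dilated_folner.
have P0 : 0 < P%:R :> R by rewrite ltr0n card_word_gt0 // card_bool.
apply: (@lt_le_trans _ _ ((16 * P%:R)^-1)); first by rewrite invr_gt0 mulr_gt0.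
apply: limn_sup_ge => [n|n0]; first exact: (ratio01 R (dilated c n) (fun h => h \in S)).
have [n n0n fn] := Hs n0; exists n => //.
have [_ h] := Hf n; rewrite fn in h.
rewrite (card_fset_cond _ (fun h => h \in S)) (sum_dilated (fun y => y \in S : nat)) //.
rewrite card_dilated //.
have d0 : 0 < #|` divs n|%:R :> R by rewrite ltr0n card_divs_gt0.
rewrite ler_pdivlMr // mulrC ler_pdivrMr ?mulr_gt0 // -natrM mulrC -natrM ler_nat.
apply: leq_trans h _; rewrite leq_mul2l /= !big_seq; apply/orP; right.
apply: leq_sum => b bd; case: eqP => // e; rewrite (_ : _ \in S) // inE; split=> //.
by rewrite /posnat /= muln_gt0 c0 (dvdn_gt0 (box_gt0 n)) // -in_divs.
Qed.

End Multiplicative.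

(** * Configurations in normal sets *)

Section Configurations.
Variable R : realType.

(** The section word of a popular section is dense enough to contain some
    a + F1, and the set of y with this section word is multiplicatively large,
    so it contains some b F2. *)
Lemma normal_product_configuration (Sa Sm : set {fset nat}) :
  (forall S : set nat, S `<=` posnat -> additively_large R S ->
     exists F1 a, [/\ Sa F1, posnat a & translate a F1 `<=` S]) ->
  (forall S : set nat, S `<=` posnat -> multiplicatively_large R S ->
     exists F2 b, [/\ Sm F2, posnat b & dilate b F2 `<=` S]) ->
  forall A : set nat, classical_normal R A ->
  exists F1 F2 a b, [/\ Sa F1, Sm F2, posnat a, posnat b &
    dilate_translate b F2 a F1 `<=` A].
Proof.
move=> HSa HSm A [_ AN]; set x := fun m => m \in A in AN.
have [N N0 HN] := additively_large_finitary HSa.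
have [s sN sL] := popular_section N0 AN.
pose E : pred nat := fun m => if insub m.-1 is Some i then s i else false.
have [|F1 [a [SF1 a0 aE]]] := HN E.
  rewrite /cnt (eq_bigr (fun m => s m : nat)) // => m _.
  by rewrite /E add0n /= valK.
have [|F2 [b [SF2 b0 bS]]] := HSm _ _ sL; first by move=> y [].
exists F1, F2, a, b; split=> // _ /= [f1 f1F [f2 f2F <-]].
have [y0 ys] : [set y | posnat y /\ section_word x N y = s] (b * f2)%N.
  by apply: bS; exists f2.
have /andP[] := aE _ f1F; rewrite /E.
case: insubP => // i _ iE si _.
have af0 : (0 < a + f1)%N by rewrite addn_gt0 [(0 < a)%N]a0.
move: si; rewrite -ys ffunE iE prednK // /x inE.
by [].
Qed.

(** The steps start at d and not at 0, as the finite sets must avoid 0. *)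
Definition arithmetic_steps (n d : nat) : {fset nat} :=
  [fset (i.+1 * d)%N | i in iota 0 n.+1]%fset.

Definition geometric_steps (n q : nat) : {fset nat} :=
  [fset (q ^ j)%N | j in iota 0 n.+1]%fset.

Lemma additively_large_progression (n : nat) (S : set nat) :
  additively_large R S -> exists d a,
    [/\ posnat d, posnat a & translate a (arithmetic_steps n d) `<=` S].
Proof.
move=> SL; have [X [v [X0 HX vn]]] := DHJ_valued R n.+1.
have [//|g _|h [c [r [h0 r0 hS]]]] := large_pattern v (e := succn) X0 HX _ _ SL.
  exact: addnI.
exists r, ((c + h).+1)%N; split=> // _ [f /imfsetP[i /= + ->] <-].
rewrite -[0%N :: _]/(iota 0 n.+1) mem_iota add0n => /= lin.
have [y vy] := vn i.+1 lin; have := hS y; rewrite vy.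
by congr S; rewrite mulnC addSn addSn addnAC.
Qed.

Lemma multiplicatively_large_progression (n : nat) (S : set nat) :
  multiplicatively_large R S -> exists q b,
    [/\ (1 < q)%N, posnat b & dilate b (geometric_steps n q) `<=` S].
Proof.
move=> SL; have [X [v [X0 HX vn]]] := DHJ_valued R n.
have [s|g g0|h [c [r [h0 r0 hS]]]] := large_pattern v (e := expn 2) X0 HX _ _ SL.
- by rewrite /posnat /= expn_gt0.
- by move=> y z /eqP; rewrite eqn_pmul2l // => /eqP.
exists (2 ^ r)%N, (2 ^ c * h)%N; split.
- by rewrite -{1}(expn0 2) ltn_exp2l.
- by rewrite /posnat /= muln_gt0 expn_gt0.
move=> _ [f /imfsetP[j /= + ->] <-].
rewrite -[0%N :: _]/(iota 0 n.+1) mem_iota add0n ltnS => /= jn.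
have [y vy] := vn j jn; have := hS y; rewrite vy.
by congr S; rewrite expnD expnM mulnAC.
Qed.

End Configurations.

Theorem theorem7p33 (R : realType) :
  (forall Sa Sm : set {fset nat},
      Sa `<=` finset_in_posnat ->
      Sm `<=` finset_in_posnat ->
      (forall S : set nat, S `<=` posnat -> additively_large R S ->
         exists F1 a, [/\ Sa F1, posnat a & translate a F1 `<=` S]) ->
      (forall S : set nat, S `<=` posnat -> multiplicatively_large R S ->
         exists F2 b, [/\ Sm F2, posnat b & dilate b F2 `<=` S]) ->
      forall A : set nat, classical_normal R A ->
        exists F1 F2 a b,
          [/\ Sa F1, Sm F2, posnat a, posnat b &
              dilate_translate b F2 a F1 `<=` A])
  /\
  (forall A : set nat, classical_normal R A ->
     forall n : nat, posnat n ->
       exists q a d,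
         [/\ (1 < q)%N, posnat a, posnat d & geo_arithmetic q a d n `<=` A]).
Proof.
split=> [Sa Sm _ _ HSa HSm A AN|A AN n _].
  exact: (normal_product_configuration HSa HSm AN).
pose Sa : set {fset nat} := [set F | exists2 d, posnat d & F = arithmetic_steps n d].
pose Sm : set {fset nat} := [set F | exists2 q, (1 < q)%N & F = geometric_steps n q].
have [||_ [_ [a [b [[d d0 ->] [q q1 ->] a0 b0 baA]]]]] :=
  @normal_product_configuration R Sa Sm _ _ A AN.
- move=> S _ /(additively_large_progression n)[d [a [d0 a0 aS]]].
  by exists (arithmetic_steps n d), a; split=> //; exists d.
- move=> S _ /(multiplicatively_large_progression n)[q [b [q1 b0 bS]]].
  by exists (geometric_steps n q), b; split=> //; exists q.
exists q, (b * (a + d))%N, (b * d)%N; split=> //.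
- by rewrite /posnat /= muln_gt0 addn_gt0 [(0 < a)%N]a0 [(0 < b)%N]b0.
- by rewrite /posnat /= muln_gt0 [(0 < d)%N]d0 [(0 < b)%N]b0.
move=> _ /= [i lin [j ljn <-]]; apply: baA.
exists (i.+1 * d)%N; first by apply/imfsetP; exists i; rewrite //= -[0%N :: _]/(iota 0 n.+1) mem_iota.
exists (q ^ j)%N; first by apply/imfsetP; exists j; rewrite //= -[0%N :: _]/(iota 0 n.+1) mem_iota.
by rewrite mulSn; ring.
Qed.
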